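(* For any $S\subseteq\{e,i,o,c\}$, we have $\mathbf{FL_S}\vdash\,\Rightarrow\Theta^*_n$ (for all $n\ge1$), and the number of lines of any proof of this sequent in $\mathbf{FL_S}$ is exponential in $n$.
   Context: **Convention.** ''Exponential in $n$'' means bounded below by $2^{n^{\Omega(1)}}$, i.e. there is $\varepsilon>0$ such that the quantity is at least $2^{n^{\varepsilon}}$ for all sufficiently large $n$. A line of a proof is a sequent occurring in it; proofs may be dag-like. **The calculus $\mathbf{FL_S}$** over $\{\wedge,\vee,*,\setminus,/,1,0\}$. Sequents $\Gamma\Rightarrow\Delta$, with $\Gamma$ a finite sequence of formulas and $\Delta$ empty or a single formula. Initial sequents: $\phi\Rightarrow\phi$; $\Rightarrow 1$; $0\Rightarrow$. Rules (premises / conclusion): (cut) $\Gamma\Rightarrow\phi$ and $\Sigma,\phi,\Pi\Rightarrow\Delta$ / $\Sigma,\Gamma,\Pi\Rightarrow\Delta$; $(1w)$ $\Gamma,\Sigma\Rightarrow\Delta$ / $\Gamma,1,\Sigma\Rightarrow\Delta$; $(0w)$ $\Gamma\Rightarrow$ / $\Gamma\Rightarrow 0$; $(L\wedge)$ $\Gamma,\phi,\Sigma\Rightarrow\Delta$ (or $\Gamma,\psi,\Sigma\Rightarrow\Delta$) / $\Gamma,\phi\wedge\psi,\Sigma\Rightarrow\Delta$; $(R\wedge)$ $\Gamma\Rightarrow\phi$ and $\Gamma\Rightarrow\psi$ / $\Gamma\Rightarrow\phi\wedge\psi$; $(L\vee)$ $\Gamma,\phi,\Sigma\Rightarrow\Delta$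 and $\Gamma,\psi,\Sigma\Rightarrow\Delta$ / $\Gamma,\phi\vee\psi,\Sigma\Rightarrow\Delta$; $(R\vee)$ $\Gamma\Rightarrow\phi$ (or $\Gamma\Rightarrow\psi$) / $\Gamma\Rightarrow\phi\vee\psi$; $(L* )$ $\Gamma,\phi,\psi,\Sigma\Rightarrow\Delta$ / $\Gamma,\phi*\psi,\Sigma\Rightarrow\Delta$; $(R* )$ $\Gamma\Rightarrow\phi$ and $\Sigma\Rightarrow\psi$ / $\Gamma,\Sigma\Rightarrow\phi*\psi$; $(L/)$ $\Gamma\Rightarrow\phi$ and $\Pi,\psi,\Sigma\Rightarrow\delta$ / $\Pi,\psi/\phi,\Gamma,\Sigma\Rightarrow\delta$; $(R/)$ $\Gamma,\phi\Rightarrow\psi$ / $\Gamma\Rightarrow\psi/\phi$; $(L\setminus)$ $\Gamma\Rightarrow\phi$ and $\Pi,\psi,\Sigma\Rightarrow\delta$ / $\Pi,\Gamma,\phi\setminus\psi,\Sigma\Rightarrow\delta$; $(R\setminus)$ $\phi,\Gamma\Rightarrow\psi$ / $\Gamma\Rightarrow\phi\setminus\psi$; and the structural rules named in $S$: $(e)$ $\Gamma,\phi,\psi,\Sigma\Rightarrow\Delta$ / $\Gamma,\psi,\phi,\Sigma\Rightarrow\Delta$; $(c)$ $\Gamma,\phi,\phi,\Sigma\Rightarrow\Delta$ / $\Gamma,\phi,\Sigma\Rightarrow\Delta$; $(i)$ $\Gamma,\Sigma\Rightarrow\Delta$ / $\Gamma,\phi,\Sigma\Rightarrow\Delta$; $(o)$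 $\Gamma\Rightarrow$ / $\Gamma\Rightarrow\phi$. **The formulas.** For $1\le k\le n$ use variables $p_{i,j},q_{i,j}$ ($0\le i,j<n$), $s_{i,l},s'_{i,l}$ ($0\le i<n$, $0\le l<k$), $r_{i,l},r'_{i,l}$ ($0\le i<n$, $0\le l<k+1$), and put $$\alpha^k_n(\bar p,\bar s,\bar s'):=\bigvee_{i<n}\bigwedge_{l<k}s'_{i,l}\ \vee\bigvee_{i,j<n}\bigvee_{l<k}(s_{i,l}\wedge s_{j,l}\wedge p_{i,j}),$$ $$\beta^{k+1}_n(\bar q,\bar r,\bar r'):=\bigvee_{l<k+1}\bigwedge_{i<n}r'_{i,l}\ \vee\bigvee_{i,j<n}\bigvee_{l<m<k+1}(r_{i,l}\wedge r_{j,m}\wedge q_{i,j}).$$ With $\bigotimes$ denoting iterated fusion $*$ in lexicographic order of the indices, $$\Theta^*_{n,k}:=\Big[\bigotimes_{i,j<n}((p_{i,j}\wedge1)\vee(q_{i,j}\wedge1))\Big]\setminus\Big(\Big[\bigotimes_{i<n,\,l<k}((s_{i,l}\wedge1)\vee(s'_{i,l}\wedge1))\setminus\alpha^k_n\Big]\vee\Big[\bigotimes_{i<n,\,l<k+1}((r_{i,l}\wedge1)\vee(r'_{i,l}\wedge1))\setminus\beta^{k+1}_n\Big]\Big),$$ and $\Theta^*_n:=\Theta^*_{n,\lfloor\sqrt n\rfloor}$. *)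

(* Defs.v *)
From HB Require Import structures.
From mathcomp Require Import all_boot.

Set Implicit Arguments.
Unset Strict Implicit.
Unset Printing Implicit Defensive.

(* The indices range over all of nat, so that proofs may use infinitely many
   variables besides those of the formulas below. *)
Inductive var : Type :=
  | Vp (i j : nat)
  | Vq (i j : nat)
  | Vs (i l : nat)
  | Vs' (i l : nat)
  | Vr (i l : nat)
  | Vr' (i l : nat).

(* [LDiv phi psi] is phi \ psi, whereas [RDiv psi phi] is psi / phi. *)
Inductive formula : Type :=
  | Var (x : var)
  | One
  | Zero
  | And (phi psi : formula)
  | Or (phi psi : formula)
  | Fus (phi psi : formula)
  | LDiv (phi psi : formula)
  | RDiv (psi phi : formula).

Declare Scope formula_scope.
Delimit Scope formula_scope with F.
Bind Scope formula_scope with formula.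
Notation "phi ∧ psi" := (And phi psi)
  (at level 45, right associativity) : formula_scope.
Notation "phi ∨ psi" := (Or phi psi)
  (at level 54, right associativity) : formula_scope.
Notation "phi ⊗ psi" := (Fus phi psi)
  (at level 45, right associativity) : formula_scope.
Notation "phi ⧵ psi" := (LDiv phi psi)
  (at level 55, no associativity) : formula_scope.
Notation "psi ⁄ phi" := (RDiv psi phi)
  (at level 55, no associativity) : formula_scope.
Notation "1" := One : formula_scope.
Notation "0" := Zero : formula_scope.

Fact var_eq_dec (x y : var) : decidable (x = y).
Proof. by rewrite /decidable; do 2!decide equality. Defined.

HB.instance Definition _ := hasDecEq.Build var (compareP var_eq_dec).

Fact formula_eq_dec (x y : formula) : decidable (x = y).
Proof. by rewrite /decidable; decide equality; apply: var_eq_dec. Defined.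

HB.instance Definition _ := hasDecEq.Build formula (compareP formula_eq_dec).

Definition sequent : Type := (seq formula * option formula)%type.

Notation "G ⇒ D" := ((G, D) : sequent) (at level 70, no associativity).

Inductive struct_rule : Type := Exch | LWeak | RWeak | Contr.

Section Calculus.

Variable S : pred struct_rule.

Local Open Scope formula_scope.

Implicit Types (G H K : seq formula) (D : option formula).

Inductive inference : seq sequent -> sequent -> Prop :=
  | ax_id phi : inference [::] ([:: phi] ⇒ Some phi)
  | ax_1 : inference [::] ([::] ⇒ Some 1)
  | ax_0 : inference [::] ([:: 0] ⇒ None)
  | cut G H K phi D :
      inference [:: G ⇒ Some phi; H ++ phi :: K ⇒ D] (H ++ G ++ K ⇒ D)
  | weak1 G H D :
      inference [:: G ++ H ⇒ D] (G ++ 1 :: H ⇒ D)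
  | weak0 G :
      inference [:: G ⇒ None] (G ⇒ Some 0)
  | L_and1 G H phi psi D :
      inference [:: G ++ phi :: H ⇒ D] (G ++ phi ∧ psi :: H ⇒ D)
  | L_and2 G H phi psi D :
      inference [:: G ++ psi :: H ⇒ D] (G ++ phi ∧ psi :: H ⇒ D)
  | R_and G phi psi :
      inference [:: G ⇒ Some phi; G ⇒ Some psi] (G ⇒ Some (phi ∧ psi))
  | L_or G H phi psi D :
      inference [:: G ++ phi :: H ⇒ D; G ++ psi :: H ⇒ D]
                (G ++ phi ∨ psi :: H ⇒ D)
  | R_or1 G phi psi :
      inference [:: G ⇒ Some phi] (G ⇒ Some (phi ∨ psi))
  | R_or2 G phi psi :
      inference [:: G ⇒ Some psi] (G ⇒ Some (phi ∨ psi))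
  | L_fus G H phi psi D :
      inference [:: G ++ phi :: psi :: H ⇒ D] (G ++ phi ⊗ psi :: H ⇒ D)
  | R_fus G H phi psi :
      inference [:: G ⇒ Some phi; H ⇒ Some psi] (G ++ H ⇒ Some (phi ⊗ psi))
  | L_rdiv G H K phi psi D :
      inference [:: G ⇒ Some phi; K ++ psi :: H ⇒ D]
                (K ++ (psi ⁄ phi) :: G ++ H ⇒ D)
  | R_rdiv G phi psi :
      inference [:: G ++ [:: phi] ⇒ Some psi] (G ⇒ Some (psi ⁄ phi))
  | L_ldiv G H K phi psi D :
      inference [:: G ⇒ Some phi; K ++ psi :: H ⇒ D]
                (K ++ G ++ (phi ⧵ psi) :: H ⇒ D)
  | R_ldiv G phi psi :
      inference [:: phi :: G ⇒ Some psi] (G ⇒ Some (phi ⧵ psi))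
  | exch G H phi psi D : S Exch ->
      inference [:: G ++ phi :: psi :: H ⇒ D] (G ++ psi :: phi :: H ⇒ D)
  | contr G H phi D : S Contr ->
      inference [:: G ++ phi :: phi :: H ⇒ D] (G ++ phi :: H ⇒ D)
  | lweak G H phi D : S LWeak ->
      inference [:: G ++ H ⇒ D] (G ++ phi :: H ⇒ D)
  | rweak G phi : S RWeak ->
      inference [:: G ⇒ None] (G ⇒ Some phi).

(* Dag-like: a line may be used as a premise any number of times. *)
Inductive derivation : seq sequent -> Prop :=
  | der_nil : derivation [::]
  | der_rcons pi prems s :
      derivation pi -> inference prems s -> {subset prems <= pi} ->
      derivation (rcons pi s).

Definition proof_of (s : sequent) (pi : seq sequent) : Prop :=
  derivation pi /\ exists pi0, pi = rcons pi0 s.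

Definition provable (s : sequent) : Prop := exists pi, proof_of s pi.

End Calculus.

(* x_1 op (x_2 op (... op x_m)), with no trailing unit.  The value on the empty
   list is junk: for 1 <= k <= n all the index ranges below are inhabited. *)
Fixpoint iterate (op : formula -> formula -> formula) (xs : seq formula) :
    formula :=
  match xs with
  | [::] => One
  | [:: x] => x
  | x :: xs' => op x (iterate op xs')
  end.

Definition bigAnd := iterate And.
Definition bigOr := iterate Or.
Definition bigFus := iterate Fus.

(* {0, .., a-1} x {0, .., b-1} in lexicographic order *)
Definition grid (a b : nat) : seq (nat * nat) :=
  [seq (i, j) | i <- iota 0 a, j <- iota 0 b].

Section Formulas.

Local Open Scope formula_scope.

Let p i j := Var (Vp i j).
Let q i j := Var (Vq i j).
Let s i l := Var (Vs i l).
Let s' i l := Var (Vs' i l).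
Let r i l := Var (Vr i l).
Let r' i l := Var (Vr' i l).

Definition alpha (n k : nat) : formula :=
  bigOr [seq bigAnd [seq s' i l | l <- iota 0 k] | i <- iota 0 n]
  ∨ bigOr [seq bigOr [seq s ij.1 l ∧ s ij.2 l ∧ p ij.1 ij.2 | l <- iota 0 k]
          | ij <- grid n n].

(* The second argument is the full superscript: beta_n^{k+1} is [beta n k.+1]. *)
Definition beta (n c : nat) : formula :=
  bigOr [seq bigAnd [seq r' i l | i <- iota 0 n] | l <- iota 0 c]
  ∨ bigOr [seq bigOr [seq r ij.1 lm.1 ∧ r ij.2 lm.2 ∧ q ij.1 ij.2
                     | lm <- grid c c & lm.1 < lm.2]
          | ij <- grid n n].

Definition Theta_star_nk (n k : nat) : formula :=
  bigFus [seq (p ij.1 ij.2 ∧ 1) ∨ (q ij.1 ij.2 ∧ 1) | ij <- grid n n]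
  ⧵ ((bigFus [seq (s il.1 il.2 ∧ 1) ∨ (s' il.1 il.2 ∧ 1) | il <- grid n k]
        ⧵ alpha n k)
     ∨ (bigFus [seq (r il.1 il.2 ∧ 1) ∨ (r' il.1 il.2 ∧ 1)
               | il <- grid n k.+1]
        ⧵ beta n k.+1)).

End Formulas.

Definition Theta_star (n : nat) : formula := Theta_star_nk n (Nat.sqrt n).

(* Main.v *)
Require Import Defs.
From mathcomp Require Import all_boot all_order all_algebra.
From mathcomp Require Import reals exp.
From mathcomp Require Import zify.
From Stdlib Require Import Setoid.
From Stdlib Require PeanoNat.

(* Read the lines [G ⇒ Some phi] of a proof of [Theta_star_nk n k] as Horn
   clauses over formulas.  Given a graph, start from the atoms [p_ij] of its
   edges and from all [q_ij], and let [T] be the closure under these clauses.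
   The Aczel slash relative to the closure started from the true [p]'s and [q]'s
   only is sound for the calculus with all structural rules, so that the left
   disjunct of [Theta_star_nk n k] or the right one enters the closure.  As
   lines are classically valid, the left one never enters for a [k]-colourable
   graph, and the right one never does for a graph with a [(k+1)]-clique.
   Membership of the left disjunct in [T] is a monotone property of the graph,
   computed by a monotone circuit of size polynomial in [n] and in the number of
   lines.  It separates cliques from colourable graphs, so the circuit is
   exponentially large by the approximation method of Razborov, in the form of
   Alon and Boppana.

   The positive tests of that argument are restricted to the cliques with one
   vertex in each of [k+1] blocks of size [k-1]; since [(k+1)(k-1) <= n] these
   fit into [n] vertices, and counting them is counting functions. *)

Import GRing.Theory Num.Theory.

Set Implicit Arguments.
Unset Strict Implicit.
Unset Printing Implicit Defensive.

(** * Sunflowers *)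

Lemma card_bigcup_le (I T : finType) (P : pred I) (F : I -> {set T}) :
  #|\bigcup_(i | P i) F i| <= \sum_(i | P i) #|F i|.
Proof.
apply: (big_ind2 (fun (X : {set T}) n => #|X| <= n)) => [|X m Y n Xm Yn|//].
  by rewrite cards0.
by rewrite (leq_trans (leq_card_setU X Y)) // leq_add.
Qed.

Section Sunflower.

Variable V : finType.
Implicit Types (X Y Z : {set V}) (F P : {set {set V}}).

Definition sunflower Y P :=
  (forall X, X \in P -> Y \subset X) /\
  {in P &, forall X X', X != X' -> X :&: X' \subset Y}.

(* Erdős-Rado, relative to a set [Z] contained in all members. *)
Lemma sunflower_rel p l Z F : 0 < p ->
  (forall X, X \in F -> Z \subset X /\ #|X :\: Z| <= l) ->
  p ^ l * l`! < #|F| ->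
  exists Y P, [/\ sunflower Y P, P \subset F & #|P| = p].
Proof.
move=> p0; elim: l Z F => [|l IH] Z F HF cF.
  (* For [l = 0] all members coincide with [Z]. *)
  suff: #|F| <= 1 by move: cF; rewrite ltnNge => /negP.
  rewrite -(cards1 Z); apply/subset_leq_card/subsetP => X XF; rewrite inE.
  have [ZX] := HF X XF; rewrite leqn0 cards_eq0 setD_eq0 => XZ.
  by rewrite eqEsubset XZ ZX.
(* A maximal subfamily [D] whose members pairwise meet only inside [Z] is a sunflower if it has [p]
   members. Otherwise the set [U] of its points outside [Z] is small and meets every member of [F]
   except [Z]; a point [v] of [U] in many members allows induction relative to [v |: Z]. *)
pose ok (D : {set {set V}}) := (D \subset F) &&
  [forall X in D, forall X' in D, (X != X') ==> (X :&: X' \subset Z)].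
have ok0 : ok set0.
  by rewrite /ok sub0set; apply/forall_inP => X; rewrite inE.
have [D /maxsetP [okD maxD] _] := maxset_exists ok0.
have [DF /forall_inP HD] := andP okD.
have sunD : sunflower Z D.
  split=> [X /(subsetP DF)/HF[] //|X X' XD X'D].
  by have /forall_inP/(_ _ X'D)/implyP := HD _ XD.
case: (leqP p #|D|) => [pD|Dp].
  have [P PD cP] : exists2 P : {set {set V}}, P \subset D & #|P| = p.
    exists [set X in take p (enum D)].
      by apply/subsetP => X; rewrite inE => /mem_take; rewrite mem_enum.
    rewrite cardsE (card_uniqP _) ?take_uniq ?enum_uniq //.
    by rewrite size_takel // -cardE.
  exists Z, P; split=> //; last exact: subset_trans PD DF.
  case: sunD => H1 H2; split=> [X|X X'] /(subsetP PD); first exact: H1.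
  by move=> XD /(subsetP PD); exact: H2.
pose U := \bigcup_(X in D) (X :\: Z).
pose Fv v := [set X in F | v \in X].
have cU : #|U| <= #|D| * l.+1.
  apply: leq_trans (card_bigcup_le _ _) _; rewrite -sum_nat_const.
  by apply: leq_sum => X /(subsetP DF)/HF[].
have FU : F \subset Z |: \bigcup_(v in U) Fv v.
  apply/subsetP => X XF; rewrite in_setU1.
  case: (eqVneq X Z) => //= XZ.
  suff [v vX vU] : exists2 v, v \in X & v \in U.
    by apply/bigcupP; exists v => //; rewrite inE XF.
  have [ZX _] := HF _ XF.
  case: (boolP (X \in D)) => XD.
    have /subsetPn[v vX vZ] : ~~ (X \subset Z).
      by apply: contra XZ => XZ; rewrite eqEsubset XZ.
    by exists v => //; apply/bigcupP; exists X; rewrite // inE vZ.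
  have : ~~ ok (X |: D).
    apply: contra XD => okXD.
    by rewrite -(maxD _ okXD (subsetUr _ _)) setU11.
  rewrite /ok subUset sub1set XF DF /= => /forall_inPn[X1 X1D].
  move=> /forall_inPn[X2 X2D]; rewrite negb_imply => /andP[X12 X12Z].
  suff [X' X'D /subsetPn[v]] : exists2 X', X' \in D & ~~ (X :&: X' \subset Z).
    rewrite inE => /andP[vX vX'] vZ; exists v => //.
    by apply/bigcupP; exists X'; rewrite // inE vZ.
  move: X1D X2D X12 X12Z; rewrite !in_setU1.
  move=> /predU1P[->|X1D] /predU1P[->|X2D]; first by rewrite eqxx.
  - by move=> _ H; exists X2.
  - by move=> _ H; exists X1; rewrite // setIC.
  - by move=> ne /negP[]; case: sunD => _; apply.
have [/exists_inP[v vU big]|] :=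
    boolP [exists v in U, p ^ l * l`! < #|Fv v|].
  have HFv X : X \in Fv v -> v |: Z \subset X /\ #|X :\: (v |: Z)| <= l.
    rewrite inE => /andP[XF vX]; have [ZX lX] := HF _ XF.
    rewrite subUset sub1set vX ZX; split=> //.
    have vZ : v \notin Z by case/bigcupP: vU => X' _; rewrite inE => /andP[].
    rewrite -ltnS (leq_trans _ lX) // setUC -setDDl [in leqRHS](cardsD1 v).
    by rewrite !inE vX vZ.
  have [Y [P [H1 H2 H3]]] := IH _ _ HFv big.
  exists Y, P; split=> //; apply: subset_trans H2 _.
  by apply/subsetP => X; rewrite inE => /andP[].
rewrite negb_exists_in => /forall_inP small.
have cFU : #|\bigcup_(v in U) Fv v| <= #|U| * (p ^ l * l`!).
  apply: leq_trans (card_bigcup_le _ _) _; rewrite -sum_nat_const.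
  by apply: leq_sum => v /small; rewrite -leqNgt.
(* If no point is in many members, [F] has at most [1 + #|U| * M] members, where
   [#|U| <= p.-1 * l.+1] and the [1] stands for [Z]. *)
have {FU} := leq_trans (subset_leq_card FU) (leq_card_setU _ _).
rewrite cards1 => FU; move: cF; rewrite ltnNge => /negP[].
rewrite (leq_trans FU) // expnS factS mulnACA.
have M0 : 0 < p ^ l * l`! by rewrite muln_gt0 expn_gt0 p0 fact_gt0.
set M := p ^ l * l`! in M0 cFU *.
rewrite -(prednK p0) mulSn.
rewrite mulnDl; apply: leq_add; first by rewrite muln_gt0.
rewrite (leq_trans cFU) // leq_mul2r (leq_trans cU) ?orbT // leq_mul2r.
by rewrite -ltnS prednK ?Dp ?orbT.
Qed.

Lemma sunflower_lemma p l F : 0 < p -> (forall X, X \in F -> #|X| <= l) ->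
  p ^ l * l`! < #|F| ->
  exists Y P, [/\ sunflower Y P, P \subset F & #|P| = p].
Proof.
move=> p0 HF; apply: (sunflower_rel (Z := set0)) => // X /HF.
by rewrite sub0set setD0.
Qed.

End Sunflower.

(** * The approximation method for monotone circuits *)

Section Approximation.

Variables (I B C : finType).
Notation V := (I * B)%type.
Notation pos := {ffun I -> B}.
Notation neg := {ffun V -> C}.
Notation test := (pos + neg)%type.
Implicit Types (X Y Z : {set V}) (F P : {set {set V}}).

(* A function [h : I -> B] stands for the clique on its graph, and a colouring
   [c] of [V] for the complete multipartite graph on its classes. *)
Definition clique (X : {set V}) (t : test) : bool :=
  match t with
  | inl h => [forall u in X, h u.1 == u.2]
  | inr c => [forall u in X, forall v in X, (c u == c v) ==> (u == v)]
  end.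

Definition edge (u v : V) : {set test} := [set t | clique [set u; v] t].

Lemma clique_sub X Y t : X \subset Y -> clique Y t -> clique X t.
Proof.
case: t => [h|c] /= /subsetP XY /forall_inP H; apply/forall_inP => u /XY /H //.
by move/forall_inP => Hu; apply/forall_inP => v /XY /Hu.
Qed.

Lemma cliquePn X (c : neg) :
  reflect (exists u v, [/\ u \in X, v \in X, u != v & c u = c v])
          (~~ clique X (inr c)).
Proof.
apply: (iffP idP) => [|[u [v [uX vX uv cuv]]]].
  move=> /forall_inPn[u uX /forall_inPn[v vX]]; rewrite negb_imply.
  by case/andP=> /eqP cuv uv; exists u, v.
apply/negP => /forall_inP/(_ _ uX)/forall_inP/(_ _ vX).
by rewrite cuv eqxx (negPf uv).
Qed.

Definition approx (F : {set {set V}}) (t : test) : bool :=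
  [exists X in F, clique X t].

(** If some function has a graph containing [X], then [X] projects injectively to [I]. All such
    functions agree on this projection and are free elsewhere. *)
Lemma card_pos_clique X l : l <= #|X| ->
  #|[set h : pos | clique X (inl h)]| * #|B| ^ l <= #|B| ^ #|I|.
Proof.
move=> lX.
have [/set0Pn[h0]|] := boolP ([set h : pos | clique X (inl h)] != set0);
  last by move/negPn/eqP => ->; rewrite cards0 mul0n.
rewrite inE /= => /forall_inP h0X.
have [b0|] := posnP #|B|.
  case: l lX => [_|l _]; last by rewrite expnS b0 mul0n muln0.
  by rewrite muln1 -card_ffun max_card.
move=> b0.
pose J := [set u.1 | u in X].
have cJ : #|J| = #|X|.
  rewrite card_in_imset // => [[i b]] [i' b'] /h0X /= /eqP <- /h0X /= /eqP <-.
  by move=> ->.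
have : [set h : pos | clique X (inl h)] \subset
    family (fun i => [pred b | (i \in J) ==> (b == h0 i)]).
  apply/subsetP => h; rewrite inE /= => /forall_inP hX.
  apply/familyP => i; apply/implyP => /imsetP[u uX ->].
  by rewrite (eqP (hX u uX)) (eqP (h0X u uX)).
move=> /subset_leq_card; rewrite card_family /image_mem foldrE big_map big_enum /=.
rewrite (bigID (mem J)) /= => /leq_trans H.
have {}H : #|[set h : pos | clique X (inl h)]| <= #|B| ^ #|~: J|.
  apply: H; rewrite -[leqRHS]mul1n; apply: leq_mul.
    rewrite big1 // => i iJ.
    rewrite (eq_card (B := pred1 (h0 i))) ?card1 // => b; rewrite !inE.
    by rewrite iJ.
  rewrite -prod_nat_const.
  rewrite [leqRHS](eq_bigl (fun i => i \notin J)) => [|i]; last by rewrite inE.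
  by apply: leq_prod => i iJ; rewrite max_card.
rewrite (leq_trans (leq_mul H (leqnn _))) // -expnD leq_pexp2l //.
by rewrite -(cardsC J) cJ addnC leq_add2r.
Qed.

(** For a uniformly random colouring, the event [Q] is independent of the colours on [D]. *)
Definition indep (Q : {set neg}) (D : {set V}) : Prop :=
  forall (c c' : neg), (forall u, u \notin D -> c u = c' u) ->
    (c \in Q) = (c' \in Q).

Lemma card_coincidence (Q : {set neg}) D u v : indep Q D -> v \in D -> u != v ->
  #|[set c in Q | c u == c v]| * #|C| <= #|Q|.
Proof.
move=> QD vD uv.
(* Recolour [v] by [a]: the old colour of [v] can be read off [c u]. *)
pose g (x : neg * C) : neg := [ffun w => if w == v then x.2 else x.1 w].
rewrite -cardsT -cardsX -(card_in_imset (f := g)).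
  apply/subset_leq_card/subsetP => _ /imsetP[[c a] ca ->].
  rewrite !inE /= andbT in ca; case/andP: ca => cQ _.
  rewrite -(QD c) // => w wD; rewrite ffunE.
  by case: eqP wD => // ->; rewrite vD.
move=> [c a] [c' a']; rewrite !inE /= !andbT.
move=> /andP[_ /eqP cuv] /andP[_ /eqP cuv'] /ffunP e.
have := e v; rewrite !ffunE eqxx /= => ->; congr pair; apply/ffunP => w.
have [->|wv] := eqVneq w v; last by have := e w; rewrite !ffunE (negPf wv).
by rewrite -cuv -cuv'; have := e u; rewrite !ffunE (negPf uv).
Qed.

(** A union bound: a clash inside [X] involves a vertex outside [Y], by injectivity on [Y]. Ordering
    the pair so that this vertex comes second, each of at most [l ^ 2] pairs clashes on a fraction
    at most [1 / #|C|] of [Q]. *)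
Lemma card_noninjective (Q : {set neg}) Y X l : 0 < l -> 2 * l ^ 2 <= #|C| ->
  Y \subset X -> #|X| <= l -> indep Q (X :\: Y) ->
  (forall c, c \in Q -> clique Y (inr c)) ->
  2 * #|[set c in Q | ~~ clique X (inr c)]| <= #|Q|.
Proof.
move=> l0 lC YX Xl QD QY.
pose E (w : V * V) := if (w.2 \in X :\: Y) && (w.1 != w.2)
  then [set c in Q | c w.1 == c w.2] else set0.
have sub : [set c in Q | ~~ clique X (inr c)] \subset
    \bigcup_(w in setX X X) E w.
  apply/subsetP => c; rewrite inE => /andP[cQ /cliquePn[u [v [uX vX uv cuv]]]].
  have [vY|vY] := boolP (v \in Y); last first.
    apply/bigcupP; exists (u, v); rewrite ?inE ?uX //.
    by rewrite /E /= inE vY vX uv inE cQ cuv /=.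
  have [uY|uY] := boolP (u \in Y); last first.
    apply/bigcupP; exists (v, u); rewrite ?inE ?uX ?vX //.
    by rewrite /E /= inE uY uX eq_sym uv inE cQ cuv /=.
  by have /negP[] : ~~ clique Y (inr c) by [apply/cliquePn; exists u, v]; apply: QY.
have lsq : 0 < l ^ 2 by rewrite expn_gt0 l0.
suff key : #|[set c in Q | ~~ clique X (inr c)]| * #|C| <= l ^ 2 * #|Q|.
  rewrite -(leq_pmul2l lsq) mulnA [l ^ 2 * 2]mulnC (leq_trans _ key) //.
  by rewrite mulnC leq_mul2l lC orbT.
apply: leq_trans (leq_mul (subset_leq_card sub) (leqnn _)) _.
apply: leq_trans (leq_mul (card_bigcup_le _ _) (leqnn _)) _.
rewrite big_distrl /=.
apply: (leq_trans (_ : _ <= \sum_(w in setX X X) #|Q|)).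
  apply: leq_sum => w _; rewrite /E; case: ifP => [/andP[w2 ne]|_].
    exact: card_coincidence QD w2 ne.
  by rewrite cards0.
rewrite sum_nat_const cardsX leq_mul2r.
by rewrite -mulnn leq_mul ?orbT.
Qed.

(** Petals are disjoint outside the core, so the condition on the other petals is independent of the
    colours on [X :\: Y]. Hence each petal [X] halves the number of colourings. *)
Lemma card_plucked l Y P : 0 < l -> 2 * l ^ 2 <= #|C| -> sunflower Y P ->
  (forall X, X \in P -> #|X| <= l) ->
  #|[set c : neg | clique Y (inr c) & [forall X in P, ~~ clique X (inr c)]]|
    * 2 ^ #|P| <= #|C| ^ #|{: V}|.
Proof.
move=> l0 lC; have [m] := ubnP #|P|; elim: m P => // m IH P mP [HY HP] Pl.
have [->|/set0Pn[X XP]] := eqVneq P set0.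
  by rewrite cards0 muln1 -card_ffun max_card.
pose P' := P :\ X.
pose Q := [set c : neg | clique Y (inr c) & [forall X in P', ~~ clique X (inr c)]].
have P'P : {subset P' <= P} by move=> Z; rewrite inE => /andP[].
have cP : #|P| = #|P'|.+1 by rewrite (cardsD1 X) XP.
have := IH P'; rewrite -ltnS -cP => /(_ mP) IHP.
have {}IHP := IHP (conj (fun Z ZP => HY _ (P'P _ ZP))
    (fun Z Z' ZP Z'P => HP _ _ (P'P _ ZP) (P'P _ Z'P)))
  (fun Z ZP => Pl _ (P'P _ ZP)).
apply: leq_trans IHP; rewrite cP expnS mulnA [_ * 2]mulnC leq_mul2r.
apply/orP; right.
apply: leq_trans (card_noninjective (Q := Q) l0 lC (HY _ XP) (Pl _ XP) _ _).
- rewrite leq_mul2l /=; apply/subset_leq_card/subsetP => c.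
  rewrite !inE => /andP[cY /forall_inP cP']; rewrite cP' // andbT.
  by apply/andP; split=> //; apply/forall_inP => Z /P'P /cP'.
- have main (c c' : neg) : (forall u, u \notin X :\: Y -> c u = c' u) ->
      c \in Q -> c' \in Q.
    move=> cc'; rewrite !inE => /andP[/forall_inP cY /forall_inP cP'].
    have agree Z u : Z \in P' -> u \in Z -> c u = c' u.
      rewrite !inE => /andP[ZX ZP] uZ; apply: cc'; rewrite inE.
      case: (boolP (u \in X)) => uX; last by rewrite andbF.
      rewrite andbT negbK; apply: (subsetP (HP Z X ZP XP ZX)).
      by rewrite inE uZ.
    apply/andP; split.
      apply/forall_inP => u uY; apply/forall_inP => v vY.
      have /forall_inP/(_ _ vY) := cY _ uY.
      by rewrite !cc' // inE ?uY ?vY.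
    apply/forall_inP => Z ZP'; have /cliquePn[u [v [uZ vZ uv cuv]]] := cP' _ ZP'.
    apply/cliquePn; exists u, v; split=> //.
    by rewrite -!(agree Z).
  by move=> c c' cc'; apply/idP/idP; apply: main => // u /cc'.
- by move=> c; rewrite inE => /andP[].
Qed.

Section LowerBound.

Variables (l p : nat).
Hypotheses (l2 : 2 <= l) (p2 : 2 <= p) (lC : 2 * l ^ 2 <= #|C|).

(** The sunflower bound: more than [M] sets of size at most [l] contain a sunflower with [p]
    petals. *)
Let M := p ^ l * l`!.

(* Repeatedly replacing the petals of a sunflower by its core. *)
Lemma pluck F : (forall X, X \in F -> #|X| <= l) ->
  exists F' (E : {set neg}), [/\ #|F'| <= M, forall X, X \in F' -> #|X| <= l,
    forall t, approx F t -> approx F' t,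
    #|E| * 2 ^ p <= #|F| * #|C| ^ #|{: V}| &
    forall c, c \notin E -> approx F' (inr c) -> approx F (inr c)].
Proof.
have l0 : 0 < l by apply: ltnW.
have p0 : 0 < p by apply: ltnW.
have [m] := ubnP #|F|; elim: m F => // m IH F mF Fl.
have [FM|MF] := leqP #|F| M.
  by exists F, set0; split; rewrite ?cards0.
have [Y [P [sun PF cP]]] := sunflower_lemma p0 Fl MF.
have Pl X : X \in P -> #|X| <= l by move/(subsetP PF)/Fl.
have [X0 X0P] : exists X, X \in P by apply/set0Pn; rewrite -card_gt0 cP.
pose F1 := Y |: (F :\: P).
(* At least two petals are traded for one core, so the family shrinks. *)
have cF1 : #|F1| < #|F|.
  rewrite (leq_ltn_trans (leq_card_setU _ _)) // cards1.
  by rewrite -(cardsID P F) (setIidPr PF) cP ltn_add2r.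
have F1l X : X \in F1 -> #|X| <= l.
  rewrite !inE => /predU1P[->|/andP[_ /Fl //]].
  by apply: leq_trans (Pl _ X0P); apply/subset_leq_card/(sun.1 _ X0P).
have [F' [E [F'M F'l F1F' cE EF']]] := IH F1 (leq_trans cF1 mF) F1l.
(* The colourings newly accepted in this round: injective on the core but on no petal. *)
pose E1 := [set c : neg | clique Y (inr c) & [forall X in P, ~~ clique X (inr c)]].
exists F', (E1 :|: E); split=> //.
- move=> t /exists_inP[X XF Xt]; apply: F1F'.
  have [XP|XP] := boolP (X \in P); apply/exists_inP.
    exists Y; first by rewrite setU11.
    exact: clique_sub (sun.1 _ XP) Xt.
  by exists X; rewrite // !inE XP XF orbT.
(* Each round costs a fraction at most [2 ^ -p] of the colourings and shrinks the family, so [#|F|]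
   such fractions pay for all rounds. *)
- have := card_plucked l0 lC sun Pl; rewrite cP -/E1 => cE1.
  rewrite (leq_trans (leq_mul (leq_card_setU _ _) (leqnn _))) // mulnDl.
  rewrite (leq_trans (leq_add cE1 cE)) // -mulSn leq_mul2r.
  by rewrite cF1 orbT.
move=> c; rewrite inE negb_or => /andP[cE1 cnE] /(EF' _ cnE)/exists_inP[X].
rewrite !inE => /predU1P[->|/andP[_ XF]] Xc; last by apply/exists_inP; exists X.
move: cE1; rewrite inE Xc /= => /forall_inPn[X' X'P]; rewrite negbK => X'c.
by apply/exists_inP; exists X'; rewrite // (subsetP PF).
Qed.

(* [f] agrees with a small union of cliques, up to losing positive tests in [Ep]
   and gaining negative tests in [En]. *)
Definition approximable (Ep : {set pos}) (En : {set neg}) (f : {set test}) :=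
  exists F, [/\ #|F| <= M, forall X, X \in F -> #|X| <= l,
    forall h, h \notin Ep -> inl h \in f -> approx F (inl h) &
    forall c, c \notin En -> approx F (inr c) -> inr c \in f].

Lemma approximable_sub (Ep Ep' : {set pos}) (En En' : {set neg}) f :
  Ep \subset Ep' -> En \subset En' ->
  approximable Ep En f -> approximable Ep' En' f.
Proof.
move=> /subsetP sp /subsetP sn [F [FM Fl H1 H2]]; exists F; split=> //.
  by move=> h nh; apply: H1; apply: contra nh => /sp.
by move=> c nc; apply: H2; apply: contra nc => /sn.
Qed.

Lemma M_gt0 : 0 < M.
Proof. by rewrite muln_gt0 expn_gt0 fact_gt0 (ltnW p2). Qed.

Lemma approximable_set0 Ep En : approximable Ep En set0.
Proof.
exists set0; split=> [|X|h _|c _]; rewrite ?cards0 ?inE //.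
by case/exists_inP => X; rewrite inE.
Qed.

Lemma approximable_setT Ep En : approximable Ep En setT.
Proof.
exists [set set0]; split=> [|X|h _ _|c _ _]; rewrite ?cards1 ?M_gt0 ?inE //.
  by move/eqP=> ->; rewrite cards0.
apply/exists_inP; exists set0; rewrite ?inE //.
by apply/forall_inP => u; rewrite inE.
Qed.

Lemma approximable_edge Ep En u v : approximable Ep En (edge u v).
Proof.
exists [set [set u; v]]; split=> [|X|h _|c _]; rewrite ?cards1 ?M_gt0 ?inE //.
- by move/eqP=> ->; rewrite cards2 (leq_trans _ l2) //; case: eqP.
- by move=> uv; apply/exists_inP; exists [set u; v]; rewrite ?inE.
- by case/exists_inP => X; rewrite inE => /eqP ->.
Qed.

(** The union of the two families introduces no error; plucking it back to [M] sets errs on negative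
    tests only. *)
Lemma approximable_setU Ep En f g :
  approximable Ep En f -> approximable Ep En g ->
  exists E : {set neg}, #|E| * 2 ^ p <= 2 * M ^ 2 * #|C| ^ #|{: V}| /\
    approximable Ep (E :|: En) (f :|: g).
Proof.
move=> [F [FM Fl F1 F2]] [G [GM Gl G1 G2]].
have FGl X : X \in F :|: G -> #|X| <= l by rewrite inE => /orP[/Fl|/Gl].
have [H [E [HM Hl H1 cE H2]]] := pluck FGl.
exists E; split.
  rewrite (leq_trans cE) // leq_mul2r (leq_trans (leq_card_setU _ _)) ?orbT //.
  rewrite (leq_trans (leq_add FM GM)) // addnn -mul2n leq_mul2l -mulnn /=.
  by rewrite leq_pmulr ?M_gt0.
exists H; split=> //.
  move=> h nh; rewrite inE => /orP[/(F1 _ nh)|/(G1 _ nh)] /exists_inP[X XF Xh];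
  by apply/H1/exists_inP; exists X; rewrite // inE XF ?orbT.
move=> c; rewrite inE negb_or => /andP[cE' cn] /(H2 _ cE') /exists_inP[X].
rewrite inE => /orP[XF|XG] Xc; rewrite inE.
  by rewrite F2 //; apply/exists_inP; exists X.
by rewrite G2 ?orbT //; apply/exists_inP; exists X.
Qed.

(** A positive test containing [X] and [Y] contains [X :|: Y], so pairwise unions approximate the
    intersection. Dropping a union with more than [l] vertices loses a fraction at most
    [1 / #|B| ^ l.+1] of the positive tests; the remaining unions are plucked. *)
Lemma approximable_setI Ep En f g :
  approximable Ep En f -> approximable Ep En g ->
  exists (E' : {set pos}) (E : {set neg}),
    [/\ #|E'| * #|B| ^ l.+1 <= M ^ 2 * #|B| ^ #|I|,
        #|E| * 2 ^ p <= 2 * M ^ 2 * #|C| ^ #|{: V}| &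
        approximable (E' :|: Ep) (E :|: En) (f :&: g)].
Proof.
move=> [F [FM Fl F1 F2]] [G [GM Gl G1 G2]].
pose FG := [set X in [set XY.1 :|: XY.2 | XY in setX F G] | #|X| <= l].
have FGl X : X \in FG -> #|X| <= l by rewrite inE => /andP[].
have [H [E [HM Hl H1 cE H2]]] := pluck FGl.
have cFG : #|setX F G| <= M ^ 2 by rewrite cardsX -mulnn leq_mul.
pose lost (XY : {set V} * {set V}) := if #|XY.1 :|: XY.2| <= l then set0 else
  [set h : pos | clique (XY.1 :|: XY.2) (inl h)].
pose E' := \bigcup_(XY in setX F G) lost XY.
exists E', E; split.
- apply: leq_trans (leq_mul (card_bigcup_le _ _) (leqnn _)) _.
  rewrite big_distrl /=.
  apply: (leq_trans (_ : _ <= \sum_(XY in setX F G) #|B| ^ #|I|)).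
    apply: leq_sum => XY _; rewrite /lost.
    case: (leqP #|XY.1 :|: XY.2| l) => [_|lXY].
      by rewrite cards0.
    exact: card_pos_clique.
  by rewrite sum_nat_const leq_mul2r cFG orbT.
- rewrite (leq_trans cE) // leq_mul2r; apply/orP; right.
  apply: leq_trans (leq_trans cFG (leq_pmull _ _)) => //.
  apply: leq_trans (leq_imset_card (fun XY => XY.1 :|: XY.2) _).
  by apply/subset_leq_card/subsetP => X; rewrite inE => /andP[].
exists H; split=> //.
  move=> h; rewrite inE negb_or => /andP[hE' hEp]; rewrite inE.
  case/andP=> /(F1 _ hEp)/exists_inP[X XF Xh] /(G1 _ hEp)/exists_inP[Y YG Yh].
  have XYh : clique (X :|: Y) (inl h).
    apply/forall_inP => u; rewrite inE => /orP[uX|uY].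
      exact: (forall_inP Xh).
    exact: (forall_inP Yh).
  apply/H1/exists_inP; exists (X :|: Y) => //; rewrite inE.
  have XYFG : (X, Y) \in setX F G by rewrite inE /= XF YG.
  rewrite (imset_f (fun XY => XY.1 :|: XY.2) XYFG) /=.
  apply: contraR hE' => lXY; apply/bigcupP; exists (X, Y) => //.
  by rewrite /lost /= (negPf lXY) inE.
move=> c; rewrite inE negb_or => /andP[cE' cn] /(H2 _ cE') /exists_inP[Z].
rewrite inE => /andP[/imsetP[[X Y]]]; rewrite inE /= => /andP[XF YG] -> _ XYc.
rewrite inE; apply/andP; split; [apply: F2|apply: G2] => //; apply/exists_inP.
  by exists X; rewrite // (clique_sub (t := inr c) _ XYc) ?subsetUl.
by exists Y; rewrite // (clique_sub (t := inr c) _ XYc) ?subsetUr.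
Qed.

Definition gens : seq {set test} :=
  set0 :: setT :: [seq edge w.1 w.2 | w : V * V].

End LowerBound.

End Approximation.

(* Monotone circuits, as straight-line programs computing in a lattice of
   sets. *)
Inductive slp (T : finType) (gs : seq {set T}) : seq {set T} -> Prop :=
  | slp_nil : slp gs [::]
  | slp_gen s f : slp gs s -> f \in gs -> slp gs (f :: s)
  | slp_setU s f g : slp gs s -> f \in s -> g \in s -> slp gs (f :|: g :: s)
  | slp_setI s f g : slp gs s -> f \in s -> g \in s -> slp gs (f :&: g :: s).

Section CircuitBound.

Variables (I B C : finType) (l p : nat).
Hypotheses (l2 : 2 <= l) (p2 : 2 <= p) (lC : 2 * l ^ 2 <= #|C|).
Notation V := (I * B)%type.
Notation pos := {ffun I -> B}.
Notation neg := {ffun V -> C}.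

Let M := p ^ l * l`!.

(** The errors of the single gates accumulate along the program, so that one pair of error sets
    serves all gates. *)
Lemma slp_approximable s : slp (gens I B C) s ->
  exists (Ep : {set pos}) (En : {set neg}),
    [/\ #|Ep| * #|B| ^ l.+1 <= size s * (M ^ 2 * #|B| ^ #|I|),
        #|En| * 2 ^ p <= size s * (2 * M ^ 2 * #|C| ^ #|{: V}|) &
        forall f, f \in s -> approximable l p Ep En f].
Proof.
have cup := leq_trans (leq_mul (leq_card_setU _ _) (leqnn _)).
elim=> {s} [|s f _ [Ep [En [cp cn H]]] fg|s f g _ [Ep [En [cp cn H]]] fs gs|
            s f g _ [Ep [En [cp cn H]]] fs gs].
- by exists set0, set0; rewrite !cards0; split.
- exists Ep, En; split.
  + by rewrite (leq_trans cp) // mulSn leq_addl.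
  + by rewrite (leq_trans cn) // mulSn leq_addl.
  move=> f'; rewrite in_cons => /predU1P[->|]; last exact: H.
  move: fg; rewrite !in_cons => /or3P[/eqP->|/eqP->|/mapP[w _ ->]].
  + exact: approximable_set0.
  + exact: approximable_setT.
  + exact: approximable_edge.
- have [E [cE HE]] := approximable_setU l2 p2 lC (H _ fs) (H _ gs).
  exists Ep, (E :|: En); split.
  + by rewrite (leq_trans cp) // mulSn leq_addl.
  + by apply: cup; rewrite mulnDl mulSn leq_add.
  move=> f'; rewrite in_cons => /predU1P[->//|/H].
  by apply: approximable_sub => //; apply: subsetUr.
- have [E' [E [cE' cE HE]]] := approximable_setI l2 p2 lC (H _ fs) (H _ gs).
  exists (E' :|: Ep), (E :|: En); split.
  + by apply: cup; rewrite mulnDl mulSn leq_add.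
  + by apply: cup; rewrite mulnDl mulSn leq_add.
  move=> f'; rewrite in_cons => /predU1P[->//|/H].
  by apply: approximable_sub => //; apply: subsetUr.
Qed.

(** If the approximator of [f] is the empty family, every positive test is an error. If it contains
    some [X], it accepts all colourings injective on [X], at least half of all colourings, and each
    of them is an error. *)
Theorem slp_clique_colouring s f : slp (gens I B C) s -> f \in s ->
  0 < #|B| -> (forall h, inl h \in f) -> (forall c, inr c \notin f) ->
  #|B| ^ l.+1 <= size s * M ^ 2 \/ 2 ^ p <= size s * (4 * M ^ 2).
Proof.
move=> /slp_approximable[Ep [En [cp cn H]]] /H[F [FM Fl F1 F2]] B0 fp fn.
have C0 : 0 < #|C|.
  by rewrite (leq_trans _ lC) // muln_gt0 expn_gt0 (ltnW l2).
have [F0|/set0Pn[X XF]] := eqVneq F set0.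
  left; have Bi : 0 < #|B| ^ #|I| by rewrite expn_gt0 B0.
  rewrite -(leq_pmul2l Bi) mulnC [leqRHS]mulnC -mulnA (leq_trans _ cp) //.
  rewrite mulnC leq_mul2r -card_ffun -cardsT subset_leq_card ?orbT //.
  apply/subsetP => h _; apply: contraT => /F1/(_ (fp h)).
  by rewrite F0 => /exists_inP[X]; rewrite inE.
right; have Cv : 0 < #|C| ^ #|{: V}| by rewrite expn_gt0 C0.
have En_sup : ~: En \subset [set c in [set: neg] | ~~ clique X (inr c)].
  apply/subsetP => c; rewrite !inE => nc; apply: contra (fn c) => Xc.
  by apply: F2 => //; apply/exists_inP; exists X.
have indepT : indep [set: neg] (X :\: set0) by move=> c c' _; rewrite !inE.
have x2 : 2 * #|[set c in [set: neg] | ~~ clique X (inr c)]| <= #|[set: neg]|.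
  apply: card_noninjective (ltnW l2) lC (sub0set X) (Fl _ XF) indepT _ => c _.
  by apply/forall_inP => u; rewrite inE.
move: x2  (subset_leq_card En_sup) (cardsC En); rewrite cardsT !card_ffun.
move: #|[set c in _ | _]| #|~: En| => x y x2 yx e.
rewrite -(leq_pmul2r Cv) (leq_trans (_ : _ <= 2 * (#|En| * 2 ^ p))) //.
  have N2 : #|C| ^ #|{: V}| <= 2 * #|En|.
    by rewrite -e; move: x2; rewrite -e; lia.
  rewrite mulnA mulnC leq_mul2r. by rewrite N2 orbT.
rewrite (leq_trans (leq_mul (leqnn 2) cn)) //.
by move: (M ^ 2) (_ ^ #|_|) => m N; lia.
Qed.

End CircuitBound.

(** * Circuits for Horn closures *)

Section Computable.

Variables (T : finType) (gs : seq {set T}).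
Implicit Types (s : seq {set T}) (f g : {set T}).

(** Ranging over all programs [s1] that contain [s] lets computations be appended one after the
    other. *)
Definition computable s c f := forall s1, slp gs s1 -> {subset s <= s1} ->
  exists s2, [/\ slp gs s2, {subset s1 <= s2}, f \in s2 & size s2 <= size s1 + c].

Lemma computable_mem s f : f \in s -> computable s 0 f.
Proof. by move=> fs s1 ss1 /(_ _ fs) fs1; exists s1; split; rewrite ?addn0. Qed.

Lemma computable_leq s c c' f : c <= c' -> computable s c f -> computable s c' f.
Proof.
move=> cc' H s1 ss1 /(H _ ss1)[s2 [? ? ? le]]; exists s2; split=> //.
by rewrite (leq_trans le) // leq_add2l.
Qed.

Lemma computable_op (op : {set T} -> {set T} -> {set T}) s c d f g :
  (forall s f g, slp gs s -> f \in s -> g \in s -> slp gs (op f g :: s)) ->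
  computable s c f -> computable s d g -> computable s (c + d).+1 (op f g).
Proof.
move=> slp_op Hf Hg s1 ss1 sub1; have [s2 [ss2 sub2 fs2 le2]] := Hf _ ss1 sub1.
have ss2' : {subset s <= s2} by move=> x /sub1/sub2.
have [s3 [ss3 sub3 gs3 le3]] := Hg _ ss2 ss2'.
exists (op f g :: s3); split; rewrite ?mem_head //.
- exact: slp_op (sub3 _ fs2) gs3.
- by move=> x /sub2/sub3 xs; rewrite in_cons xs orbT.
by rewrite /= -addnS addnA addnS ltnS (leq_trans le3) // leq_add2r.
Qed.

(** Repeated sets are counted once, so the cost does not grow with the length of [B]. *)
Lemma computable_all s (B : seq {set T}) : setT \in s -> {subset B <= s} ->
  computable s (size (undup B)) [set t | all (fun f => t \in f) B].
Proof.
move=> sT Bs.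
have -> : [set t | all (fun f : {set T} => t \in f) B] =
          [set t | all (fun f => t \in f) (undup B)].
  by apply/setP => t; rewrite !inE; apply: eq_all_r => x; rewrite mem_undup.
have : {subset undup B <= s} by move=> x; rewrite mem_undup; apply: Bs.
elim: (undup B) => [|f U IH] /= Us.
  rewrite (_ : [set t | _] = setT); first exact: computable_mem.
  by apply/setP => t; rewrite !inE.
rewrite (_ : [set t | _] = f :&: [set t | all (fun f => t \in f) U]); last first.
  by apply/setP => t; rewrite !inE.
rewrite -[size U]add0n; apply: computable_op => [|//|].
- exact: slp_setI.
- by apply/computable_mem/Us/mem_head.
by apply: IH => x xU; apply: Us; rewrite in_cons xU orbT.
Qed.

Lemma computable_has (J : eqType) s c (r : seq J) (F : J -> {set T}) :
  set0 \in s -> (forall x, x \in r -> computable s c (F x)) ->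
  computable s (size r * c.+1) [set t | has (fun x => t \in F x) r].
Proof.
move=> s0; elim: r => [|x r IH] Fr /=.
  rewrite (_ : [set t | _] = set0); first exact: computable_mem.
  by apply/setP => t; rewrite !inE.
rewrite (_ : [set t | _] = F x :|: [set t | has (fun x => t \in F x) r]);
  last by apply/setP => t; rewrite !inE.
rewrite mulSn addSn; apply: computable_op; first exact: slp_setU.
  exact/Fr/mem_head.
by apply: IH => y yr; apply: Fr; rewrite in_cons yr orbT.
Qed.

Lemma slp_extend s c (fs : seq {set T}) : slp gs s ->
  (forall f, f \in fs -> computable s c f) ->
  exists s', [/\ slp gs s', {subset s <= s'}, {subset fs <= s'} &
    size s' <= size s + size fs * c].
Proof.
move=> ss; elim: fs => [|f fs IH] H; first by exists s; rewrite addn0; split.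
have [g gfs|s1 [ss1 sub1 fs1 le1]] := IH.
  by apply: H; rewrite in_cons gfs orbT.
have [s2 [ss2 sub2 fs2 le2]] := H f (mem_head _ _) _ ss1 sub1.
exists s2; split=> //.
- by move=> x /sub1/sub2.
- by move=> x; rewrite in_cons => /predU1P[->//|/fs1/sub2].
by rewrite (leq_trans le2) // /= mulSn [c + _]addnC addnA leq_add2r.
Qed.

Lemma slp_subset s : {subset s <= gs} -> slp gs s.
Proof.
elim: s => [|f s IH] H; first exact: slp_nil.
apply: slp_gen; last by apply: H; rewrite mem_head.
by apply: IH => x xs; apply: H; rewrite in_cons xs orbT.
Qed.

End Computable.

Lemma count_lt (A : eqType) (a1 a2 : pred A) s x : subpred a1 a2 ->
  x \in s -> a2 x -> ~~ a1 x -> count a1 s < count a2 s.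
Proof.
move=> a12 xs a2x a1x; case/splitPr: xs => r1 r2.
rewrite !count_cat /= a2x (negPf a1x) add0n add1n addnS ltnS.
by rewrite leq_add ?sub_count.
Qed.

Section HornClosure.

Variable pi : seq sequent.
Implicit Type X : pred formula.

(* Each line [G ⇒ Some phi] of [pi] is read as the Horn clause deriving [phi]
   from all members of [G]. *)
Definition horn_step X : pred formula := fun phi =>
  X phi || has (fun s => (s.2 == Some phi) && all X s.1) pi.

Definition horn i X := iter i horn_step X.

Definition horn_closed X :=
  forall G phi, (G ⇒ Some phi) \in pi -> all X G -> X phi.

Lemma horn_leq i j X phi : i <= j -> horn i X phi -> horn j X phi.
Proof.
move=> /subnK <-; elim: (j - i) => // d IH /IH H.
by rewrite addSn /horn iterS /horn_step -/(horn _ _) H.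
Qed.

Lemma horn_sub i X X' : (forall phi, X phi -> X' phi) ->
  forall phi, horn i X phi -> horn i X' phi.
Proof.
move=> XX'; elim: i => // i IH phi; rewrite /horn !iterS.
move=> /orP[/IH H|/hasP[s spi /andP[s2 Xs]]]; apply/orP; [left|right]=> //.
by apply/hasP; exists s; rewrite // s2 (sub_all IH).
Qed.

(** Until closure is reached, each round derives the succedent of a further line, which can happen
    at most [size pi] times. *)
Lemma horn_closed_ex X : exists2 i, i <= size pi & horn_closed (horn i X).
Proof.
pose a i (s : sequent) := if s.2 is Some phi then horn i X phi else false.
have aS i : subpred (a i) (a i.+1).
  by move=> [G [phi|]] //=; apply: horn_leq.
have grow i : horn_closed (horn i X) \/ count (a i) pi < count (a i.+1) pi.
  have [clos|] := boolP (all (fun s : sequent =>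
      if s.2 is Some phi then all (horn i X) s.1 ==> horn i X phi else true) pi).
    by left=> G phi /(allP clos)/implyP H /H.
  move=> /allPn[[G [phi|//]] Gpi]; rewrite negb_imply => /andP[GX nphi].
  right; apply: (count_lt (aS i) Gpi) => //.
  apply/orP; right; apply/hasP; exists (G ⇒ Some phi) => //=.
  by rewrite eqxx.
have claim m : (exists2 i, i <= m & horn_closed (horn i X)) \/
    m < count (a m.+1) pi.
  elim: m => [|m [[i im H]|le]].
  - have [H|lt] := grow 0; [by left; exists 0|right].
    exact: leq_ltn_trans lt.
  - by left; exists i; first exact: leqW.
  - have [H|lt] := grow m.+1; [by left; exists m.+1|right].
    exact: leq_ltn_trans lt.
have [//|lt] := claim (size pi).
by have := leq_trans lt (count_size _ _); rewrite ltnn.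
Qed.

End HornClosure.

Section HornCircuit.

Variables (T : finType) (gs : seq {set T}) (pi : seq sequent).
Variable X : T -> pred formula.
Hypotheses (gs0 : set0 \in gs) (gsT : setT \in gs).
Hypothesis gsX : forall phi, [set t | X t phi] \in gs.

Let w i phi := [set t | horn pi i (X t) phi].

(** One round for one formula: a union over the lines of intersections of at most
    [size gs + size pi] sets, joined to the previous value. *)
Let cost := (size pi * (size gs + size pi).+1).+1.

(** Thus only the succedents of [pi] need gates; the sets of all other formulas remain
    generators. *)
Lemma horn_heads i t phi : phi \notin pmap snd pi ->
  horn pi i (X t) phi = X t phi.
Proof.
move=> nphi; elim: i => // i IH; rewrite /horn iterS /horn_step -/(horn _ _ _) IH.
case: hasP => [[s spi /andP[/eqP s2 _]]|]; last by rewrite orbF.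
by case/negP: nphi; rewrite mem_pmap -s2 map_f.
Qed.

Lemma slp_horn i : exists s, [/\ slp gs s, {subset gs <= s},
  forall phi, w i phi \in s & size s <= size gs + i * (size pi * cost)].
Proof.
elim: i => [|i [s [ss sub ws le]]].
  by exists gs; split; rewrite ?addn0 //; apply: slp_subset.
have [|s' [ss' sub' fs' le']] :=
    slp_extend (c := cost) (fs := [seq w i.+1 phi | phi <- pmap snd pi]) ss.
  move=> _ /mapP[phi phi_head ->].
  pose F (q : sequent) := if q.2 == Some phi
    then [set t | all (fun f : {set T} => t \in f) [seq w i psi | psi <- q.1]]
    else set0.
  have -> : w i.+1 phi = w i phi :|: [set t | has (fun q => t \in F q) pi].
    apply/setP => t; rewrite !inE /horn iterS; congr orb.
    apply: eq_has => q; rewrite /F; case: eqP => _; rewrite inE //=.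
    by rewrite all_map; apply: eq_all => psi; rewrite /= inE.
  apply: (computable_op (c := 0) (d := size pi * _)).
  - exact: slp_setU.
  - exact/computable_mem/ws.
  apply: computable_has => [|q _]; first exact: sub.
  rewrite /F; case: eqP => _; last first.
    exact/(computable_leq (leq0n _))/computable_mem/sub.
  apply: computable_leq (computable_all (sub _ gsT) _) => [|_ /mapP[psi _ ->] //].
  (* An antecedent may be arbitrarily long, but the distinct sets of its formulas are generators or
     belong to succedents of [pi]. *)
  apply: leq_trans (_ : size (gs ++ [seq w i psi | psi <- pmap snd pi]) <= _).
    apply: uniq_leq_size (undup_uniq _) _ => x.
    rewrite mem_undup mem_cat => /mapP[psi _ ->].
    have [psi_head|nhead] := boolP (psi \in pmap snd pi).
      by rewrite map_f ?orbT.
    rewrite (_ : w i psi = [set t | X t psi]) ?gsX //.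
    by apply/setP => t; rewrite !inE horn_heads.
  by rewrite size_cat leq_add2l size_map size_pmap count_size.
exists s'; split=> //.
- by move=> x /sub/sub'.
- move=> phi; have [phi_head|nhead] := boolP (phi \in pmap snd pi).
    exact/fs'/map_f.
  rewrite (_ : w i.+1 phi = [set t | X t phi]); first exact/sub'/sub/gsX.
  by apply/setP => t; rewrite !inE horn_heads.
rewrite (leq_trans le') // mulSn [size pi * cost + _]addnC addnA leq_add //.
by rewrite leq_mul2r size_map size_pmap count_size orbT.
Qed.

Lemma slp_horn_size : exists s, [/\ slp gs s, forall phi, w (size pi) phi \in s
  & size s <= (size gs + size pi).+2 ^ 4].
Proof.
have [s [ss _ ws le]] := slp_horn (size pi); exists s; split=> //.
apply: leq_trans le _; rewrite /cost.
move: (size gs) (size pi) => g m.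
apply: leq_trans (_ : (g + m).+2 * ((g + m).+2 * ((g + m).+2 * (g + m).+2)) <= _).
  nia.
by rewrite !expnS expn0 muln1.
Qed.

End HornCircuit.

(** * The slash and monotone interpolation *)

Section Slash.

Variables (T : pred formula) (V : pred var).
Implicit Types (G H : seq formula).

(* The Aczel slash, relative to an arbitrary set [T] of formulas and with the
   variables decided by [V].  For [T := predT] this is classical truth. *)
Fixpoint slash (phi : formula) : Prop :=
  T phi /\ match phi with
  | Var x => V x
  | One => True
  | Zero => False
  | And a b | Fus a b => slash a /\ slash b
  | Or a b => slash a \/ slash b
  | LDiv a b | RDiv b a => slash a -> slash b
  end.

Lemma slash_in phi : slash phi -> T phi.
Proof. by case: phi => [x|||a b|a b|a b|a b|a b] []. Qed.

Fixpoint slashes G : Prop :=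
  if G is phi :: G' then slash phi /\ slashes G' else True.

Lemma slashes_cat G H : slashes (G ++ H) <-> slashes G /\ slashes H.
Proof. by elim: G => [|phi G IH] /=; tauto. Qed.

Lemma slashes_all G : slashes G -> all T G.
Proof. by elim: G => //= phi G IH [/slash_in -> /IH]. Qed.

Definition slash_sequent (s : sequent) : Prop :=
  slashes s.1 -> if s.2 is Some phi then slash phi else False.

(** Order and multiplicity are invisible to [slashes], so the structural rules are sound. A new
    succedent must also lie in [T]; this is [HT], because slashed antecedents lie in [T]. *)
Lemma slash_inference S prems s :
  (forall G phi, s = (G ⇒ Some phi) -> all T G -> T phi) ->
  inference S prems s -> (forall s', s' \in prems -> slash_sequent s') ->
  slash_sequent s.
Proof.
move=> HT inf.
have {}HT G phi : s = (G ⇒ Some phi) -> slashes G -> T phi.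
  by move=> e /slashes_all; apply: HT e.
move=> prem; have {prem} : foldr (fun s' => and (slash_sequent s')) True prems.
  elim: prems prem {inf} => //= s' prems IH prem; split.
    exact/prem/mem_head.
  by apply: IH => s'' s''P; apply: prem; rewrite in_cons s''P orbT.
case: inf HT => *; match goal with H : foldr _ _ _ |- _ => move: H end;
  try match goal with H : forall G phi, _ |- _ => have := H _ _ erefl end;
  rewrite /slash_sequent /=;
  repeat (setoid_rewrite slashes_cat; simpl slashes); tauto.
Qed.

Lemma slash_derivation S pi s : horn_closed pi T -> derivation S pi ->
  s \in pi -> slash_sequent s.
Proof.
(* The induction runs over initial segments [pi'], while [T] stays closed under all of [pi]. *)
move=> clos der; suff H pi' : derivation S pi' -> {subset pi' <= pi} ->
  forall q, q \in pi' -> slash_sequent q by apply: (H pi).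
move=> {}der; elim: der => {s} // {}pi' prems s _ IH inf sub ss q.
have {}IH q' : q' \in pi' -> slash_sequent q'.
  by apply: IH => x xpi; apply: ss; rewrite mem_rcons in_cons xpi orbT.
rewrite mem_rcons in_cons => /predU1P[->|/IH //].
apply: slash_inference inf _ => [G phi e|q' /sub/IH //].
by apply: clos; rewrite -e ss // mem_rcons mem_head.
Qed.

Lemma slash_bigAnd xs : slash (bigAnd xs) -> forall x, x \in xs -> slash x.
Proof.
elim: xs => // x [|y xs] IH; first by move=> sx z; rewrite inE => /eqP->.
by case=> _ [sx /IH H] z; rewrite in_cons => /predU1P[->|/H].
Qed.

Lemma slash_bigOr xs : xs != [::] -> slash (bigOr xs) ->
  exists2 x, x \in xs & slash x.
Proof.
elim: xs => // x [|y xs] IH _; first by exists x; rewrite // mem_head.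
case=> _ [sx|/IH[//|z zxs sz]]; first by exists x; rewrite // mem_head.
by exists z; rewrite // in_cons zxs orbT.
Qed.

End Slash.

Lemma slash_bigFus V xs : (forall x, x \in xs -> slash predT V x) ->
  slash predT V (bigFus xs).
Proof.
elim: xs => // x [|y xs] IH H; first exact/H/mem_head.
split=> //; split; first exact/H/mem_head.
by apply: IH => z zxs; apply: H; rewrite in_cons zxs orbT.
Qed.

(** * The antecedent of the formula as Horn axioms *)

Section Hypotheses.

Local Open Scope formula_scope.

Definition pq_disjuncts (n : nat) : seq formula :=
  [seq (Var (Vp ij.1 ij.2) ∧ 1) ∨ (Var (Vq ij.1 ij.2) ∧ 1) | ij <- grid n n].

Definition colour_part (n k : nat) : formula :=
  bigFus [seq (Var (Vs il.1 il.2) ∧ 1) ∨ (Var (Vs' il.1 il.2) ∧ 1)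
         | il <- grid n k]
  ⧵ alpha n k.

Definition clique_part (n c : nat) : formula :=
  bigFus [seq (Var (Vr il.1 il.2) ∧ 1) ∨ (Var (Vr' il.1 il.2) ∧ 1)
         | il <- grid n c]
  ⧵ beta n c.

Lemma Theta_star_nkE n k : Theta_star_nk n k =
  bigFus (pq_disjuncts n) ⧵ (colour_part n k ∨ clique_part n k.+1).
Proof. by []. Qed.

Lemma mem_grid a b i j : ((i, j) \in grid a b) = (i < a) && (j < b).
Proof.
apply/allpairsP/andP => [[[i' j'] /= [] + + [-> ->]]|[ia jb]].
  by rewrite !mem_iota.
by exists (i, j); rewrite !mem_iota.
Qed.

(** The axioms independent of the graph. The suffixes occur because [bigFus] nests to the right and
    the slash asks for membership in [T] at every level. *)
Definition pq_constants (n : nat) : seq formula :=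
  1 :: pq_disjuncts n ++
    [seq bigFus (drop i (pq_disjuncts n)) | i <- iota 0 (size (pq_disjuncts n))].

(* The formulas needed in a set for the slash of the fusion of the
   [(p ∧ 1) ∨ (q ∧ 1)], when [P] and [Q] are the true [p]'s and [q]'s. *)
Definition pq_axioms (P Q : nat -> nat -> bool) (n : nat) (phi : formula) :
    bool :=
  match phi with
  | Var (Vp i j) | Var (Vp i j) ∧ 1 => P i j
  | Var (Vq i j) | Var (Vq i j) ∧ 1 => Q i j
  | _ => phi \in pq_constants n
  end.

Lemma pq_axioms_sub (P P' Q Q' : nat -> nat -> bool) n :
  (forall i j, P i j -> P' i j) -> (forall i j, Q i j -> Q' i j) ->
  forall phi, pq_axioms P Q n phi -> pq_axioms P' Q' n phi.
Proof.
move=> PP QQ; case=> [[i j|i j|i j|i j|i j|i j]|||a b|a b|a b|a b|a b] //=; auto.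
by case: a => [[i j|i j|i j|i j|i j|i j]|||? ?|? ?|? ?|? ?|? ?] //; case: b; auto.
Qed.

(** As a function of the graph, each axiom is a constant or a single variable, hence a possible
    input of a circuit. *)
Lemma pq_axiomsP n phi :
  [\/ exists b, forall P Q, pq_axioms P Q n phi = b,
      exists i j, forall P Q, pq_axioms P Q n phi = P i j |
      exists i j, forall P Q, pq_axioms P Q n phi = Q i j].
Proof.
case: phi => [[i j|i j|i j|i j|i j|i j]|||a b|a b|a b|a b|a b];
  try (by constructor 1; eexists (_ \in pq_constants n));
  [constructor 2|constructor 3|].
- by exists i, j.
- by exists i, j.
case: a => [[i j|i j|i j|i j|i j|i j]|||? ?|? ?|? ?|? ?|? ?];
  try (by constructor 1; eexists (_ \in pq_constants n));
  case: b => [?|||? ?|? ?|? ?|? ?|? ?];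
  try (by constructor 1; eexists (_ \in pq_constants n));
  [constructor 2|constructor 3]; by exists i, j.
Qed.

Section SlashHypotheses.

Variables (T : pred formula) (V : pred var) (P Q : nat -> nat -> bool) (n : nat).
Hypothesis TPQ : forall phi, pq_axioms P Q n phi -> T phi.
Hypothesis VP : forall i j, P i j -> V (Vp i j).
Hypothesis VQ : forall i j, Q i j -> V (Vq i j).
Hypothesis PQ : forall i j, i < n -> j < n -> P i j || Q i j.

Lemma slash_pq_disjunct phi : phi \in pq_disjuncts n -> slash T V phi.
Proof.
move=> phi_in; have /mapP[[i j]] := phi_in.
rewrite mem_grid => /andP[/= ilt jlt] e; rewrite e in phi_in *.
have T1 : T 1 by apply: TPQ; rewrite /= mem_head.
split; first by apply: TPQ; rewrite /= in_cons mem_cat phi_in orbT.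
by have /orP[Pij|Qij] := PQ ilt jlt; [left|right]; do ?split=> //;
  do ?apply: TPQ; auto.
Qed.

Lemma slash_pq_suffix ys zs : pq_disjuncts n = zs ++ ys -> slash T V (bigFus ys).
Proof.
elim: ys zs => [|y [|y' ys] IH] zs e.
- by split=> //; apply: TPQ; rewrite /= mem_head.
- by apply: slash_pq_disjunct; rewrite e mem_cat mem_head orbT.
have IHzs := IH (rcons zs y); rewrite cat_rcons in IHzs.
split; last by split; [apply: slash_pq_disjunct; rewrite e mem_cat mem_head orbT|
                       exact: IHzs].
apply: TPQ; rewrite /= in_cons mem_cat; apply/or3P; apply: Or33.
apply/mapP; exists (size zs); last by rewrite e drop_size_cat.
by rewrite mem_iota e size_cat /= add0n -[ltnLHS]addn0 ltn_add2l.
Qed.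

Lemma slash_pq_axioms phi : pq_axioms P Q n phi -> slash T V phi.
Proof.
have other psi : psi \in pq_constants n -> slash T V psi.
  rewrite in_cons mem_cat => /or3P[/eqP->|/slash_pq_disjunct //|/mapP[i _ ->]].
    by apply: (@slash_pq_suffix [::] (pq_disjuncts n)); rewrite cats0.
  by apply: (@slash_pq_suffix _ (take i (pq_disjuncts n))); rewrite cat_take_drop.
have T1 : slash T V 1 by apply: other; rewrite mem_head.
case: phi => [[i j|i j|i j|i j|i j|i j]|||a b|a b|a b|a b|a b] H;
  try exact: other; try by split; [exact: TPQ|auto].
case: a H => [[i j|i j|i j|i j|i j|i j]|||? ?|? ?|? ?|? ?|? ?] H;
  try exact: other;
case: b H => [?|||? ?|? ?|? ?|? ?|? ?] H; try exact: other;
  split; do ?(apply: TPQ; exact: H); split=> //; split=> //; by [apply: TPQ|auto].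
Qed.

End SlashHypotheses.

(** The proved formula and the fusion of the [(p ∧ 1) ∨ (q ∧ 1)] are slashed, hence so is one of the
    disjuncts, which then lies in [T]. The choice [V := predT] leaves membership in [T] as the only
    condition on variables. *)
Lemma Theta_star_disjunction S pi n k T P Q :
  derivation S pi -> ([::] ⇒ Some (Theta_star_nk n k)) \in pi ->
  horn_closed pi T -> (forall phi, pq_axioms P Q n phi -> T phi) ->
  (forall i j, i < n -> j < n -> P i j || Q i j) ->
  T (colour_part n k) \/ T (clique_part n k.+1).
Proof.
move=> der pi_in clos TPQ PQ.
have := slash_derivation (V := predT) clos der pi_in I.
rewrite Theta_star_nkE => -[_].
have := @slash_pq_suffix T predT _ _ _ TPQ (fun _ _ _ => isT)
  (fun _ _ _ => isT) PQ _ [::] erefl.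
by move=> H /(_ H) [_ [[H' _]|[H' _]]]; [left|right].
Qed.

(** With [T := predT] the slash is classical truth, so every line preserves it and the closure of
    true axioms is true. *)
Lemma horn_sound S pi n (P Q : nat -> nat -> bool) (V : pred var) i phi :
  derivation S pi -> (forall i j, i < n -> j < n -> P i j || Q i j) ->
  (forall i j, P i j -> V (Vp i j)) -> (forall i j, Q i j -> V (Vq i j)) ->
  horn pi i (pq_axioms P Q n) phi -> slash predT V phi.
Proof.
move=> der PQ VP VQ; elim: i phi => [|i IH] phi.
  by apply: slash_pq_axioms.
rewrite /horn iterS => /orP[/IH //|/hasP[[G D] /= s_in /andP[/eqP e GX]]].
rewrite {D}e in s_in; have clos : horn_closed pi predT by [].
apply: (slash_derivation clos der s_in) => /=.
by elim: G GX {s_in} => //= psi G IHG /andP[/IH ? /IHG].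
Qed.

End Hypotheses.

(** * Separation of clique tests from colouring tests *)

Section Separation.

Variables (n k : nat).
Hypotheses (n0 : 0 < n) (k0 : 0 < k) (kn : k.+1 * k.-1 <= n).

Notation I := 'I_k.+1.
Notation B := 'I_k.-1.
Notation C := 'I_k.
Notation V := (I * B)%type.
Notation pos := {ffun I -> B}.
Notation neg := {ffun V -> C}.
Notation test := (pos + neg)%type.

(** The blocks are numbered consecutively; vertices from [k.+1 * k.-1] on will be isolated in every
    test graph. *)
Definition vertex (u : V) : nat := u.1 * k.-1 + u.2.

Lemma vertex_lt u : vertex u < n.
Proof.
case: u => [[i ik] [b bk]]; rewrite /vertex /=.
by apply: leq_trans kn; nia.
Qed.

Lemma vertex_inj : injective vertex.
Proof.
move=> [[i ik] [b bk]] [[i' ik'] [b' bk']]; rewrite /vertex /= => e.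
have b0 : 0 < k.-1 by apply: leq_ltn_trans bk.
have ei : i = i'.
  have := congr1 (divn^~ k.-1) e.
  by rewrite !divnMDl // !divn_small // !addn0.
have eb : b = b' by move: e; rewrite ei => /addnI.
by congr pair; apply: val_inj.
Qed.

Definition of_vertex (i : nat) : option V := [pick u | vertex u == i].

Lemma vertexK u : of_vertex (vertex u) = Some u.
Proof.
rewrite /of_vertex; case: pickP => [v /eqP/vertex_inj-> //|/(_ u)].
by rewrite eqxx.
Qed.

(** Loops are excluded explicitly: a colouring accepts every singleton, while [alpha] has disjuncts
    with [i = j]. *)
Definition test_edge (t : test) (i j : nat) : bool :=
  match of_vertex i, of_vertex j with
  | Some u, Some v => (u != v) && clique [set u; v] t
  | _, _ => false
  end.

(** With every [q] an axiom, the axioms depend on the graph only through its edges, and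
    monotonically. *)
Definition all_q (t : test) (phi : formula) :=
  pq_axioms (test_edge t) (fun _ _ => true) n phi.

Lemma all_q_gens phi : [set t | all_q t phi] \in gens I B C.
Proof.
have constE b : [set t : test | b] \in gens I B C.
  case: b; [rewrite (_ : [set t | _] = setT)|rewrite (_ : [set t | _] = set0)];
  by rewrite ?in_cons ?eqxx ?orbT //; apply/setP => t; rewrite !inE.
have edgeE i j : [set t | test_edge t i j] \in gens I B C.
  rewrite /test_edge; case: of_vertex => [u|]; last exact: constE.
  case: of_vertex => [v|]; last exact: constE.
  have [->|uv] /= := eqVneq u v; first exact: constE.
  rewrite !in_cons; apply/or3P/Or33; exact: (image_f _ (x := (u, v))).
rewrite /all_q; have [[b E]|[i [j E]]|[i [j E]]] := pq_axiomsP n phi.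
- by rewrite (_ : [set t | _] = [set t | b]) //; apply/setP => t; rewrite !inE E.
- rewrite (_ : [set t | _] = [set t | test_edge t i j]) //.
  by apply/setP => t; rewrite !inE E.
- rewrite (_ : [set t | _] = [set t | true]) //.
  by apply/setP => t; rewrite !inE E.
Qed.

Lemma edge_adjacent t i j : test_edge t i j ->
  exists u v, [/\ of_vertex i = Some u, of_vertex j = Some v, u != v &
    clique [set u; v] t].
Proof.
rewrite /test_edge; case: of_vertex => // u; case: of_vertex => // v.
by case/andP=> uv cl; exists u, v.
Qed.

(** The default colour [0] is harmless, since vertices outside the blocks are isolated. *)
Definition colour (c : neg) (i : nat) : nat :=
  if of_vertex i is Some u then c u else 0.

Definition colour_val (c : neg) (x : var) : bool :=
  match x with
  | Vp i j => test_edge (inr c) i j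
  | Vs i l => colour c i == l
  | Vs' i l => colour c i != l
  | _ => true
  end.

(** The [s] describe a proper colouring with [k] colours, whereas [alpha] asks for an uncoloured
    vertex or a monochromatic edge. *)
Lemma colour_part_false c : ~ slash predT (colour_val c) (colour_part n k).
Proof.
case=> _ []; first apply: slash_bigFus => _ /mapP[[i l] _ ->] /=.
  by split=> //; case: (_ == l); [left|right].
move=> _ [H|H].
  have [|_ /mapP[i _ ->] /slash_bigAnd Hi] := slash_bigOr _ H.
    by rewrite -size_eq0 size_map size_iota -lt0n.
  have ci : colour c i < k by rewrite /colour; case: of_vertex.
  have [|_] := Hi (Var (Vs' i (colour c i))); last by rewrite /= eqxx.
  by apply: map_f; rewrite mem_iota.
have [|_ /mapP[[i j] _ ->] /= {}H] := slash_bigOr _ H.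
  by rewrite -size_eq0 size_map size_allpairs !size_iota -lt0n muln_gt0 n0.
have [|_ /mapP[l _ ->] /= {}H] := slash_bigOr _ H.
  by rewrite -size_eq0 size_map size_iota -lt0n.
case: H => _ [[_ /eqP ci] [_ [[_ /eqP cj]]]].
case=> _ /edge_adjacent[u [v [iu jv uv cl]]].
have /negP[] : ~~ clique [set u; v] (inr c); last by [].
  apply/cliquePn; exists u, v; split=> //; rewrite ?set21 ?set22 //.
  apply: val_inj; move: ci cj; rewrite /colour iu jv => ci /esym.
  exact: etrans.
Qed.

Definition clique_val (h : pos) (x : var) : bool :=
  match x with
  | Vp i j => test_edge (inl h) i j
  | Vq i j => ~~ test_edge (inl h) i j
  | Vr i l => [exists m : I, (val m == l) && (i == vertex (m, h m))]
  | Vr' i l => ~~ [exists m : I, (val m == l) && (i == vertex (m, h m))]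
  | _ => true
  end.

(** The [r] enumerate the clique of the vertices [(m, h m)], whereas [beta] asks for an unoccupied
    position or two positions holding a non-edge. *)
Lemma clique_part_false h : ~ slash predT (clique_val h) (clique_part n k.+1).
Proof.
case=> _ []; first apply: slash_bigFus => _ /mapP[[i l] _ ->] /=.
  by split=> //; case: [exists m, _]; [left|right].
move=> _ [H|H].
  have [//|_ /mapP[l l_in ->] /slash_bigAnd Hl] := slash_bigOr _ H.
  move: l_in; rewrite mem_iota => /= lk; pose m : I := Ordinal lk.
  have [|_ /negP[]] := Hl (Var (Vr' (vertex (m, h m)) l)).
    by apply: map_f; rewrite mem_iota vertex_lt.
  by apply/existsP; exists m; rewrite !eqxx.
have [|_ /mapP[[i j] _ ->] /= {}H] := slash_bigOr _ H.
  by rewrite -size_eq0 size_map size_allpairs !size_iota -lt0n muln_gt0 n0.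
have [|_ /mapP[[l m] + ->]] := slash_bigOr _ H.
  rewrite -size_eq0 size_map -lt0n size_filter -has_count.
  (* An empty [bigOr] would be the true formula [One]; [0 < k] provides a pair of positions. *)
  have in01 : (0, 1) \in grid k.+1 k.+1 by rewrite mem_grid /= ltnS.
  by apply/hasP; exists (0, 1).
rewrite mem_filter => /andP[/= lm _] /= [_ [[_ il] [_ [[_ jm] [_ /negP[]]]]]].
have /existsP[l' /andP[/eqP el /eqP ei]] := il.
have /existsP[m' /andP[/eqP em /eqP ej]] := jm.
rewrite /test_edge ei ej !vertexK; apply/andP; split.
  by apply: contraTneq lm => -[e _]; rewrite -el -em e ltnn.
by apply/forall_inP => u; rewrite !inE => /orP[]/eqP->.
Qed.

(* For a positive test, the closure computed with all [q]'s contains the one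
   computed with only the [q]'s of non-edges, where the disjunction property
   and classical soundness force [colour_part]. *)
Lemma horn_pos S pi h : derivation S pi ->
  ([::] ⇒ Some (Theta_star_nk n k)) \in pi ->
  horn pi (size pi) (all_q (inl h)) (colour_part n k).
Proof.
move=> der pi_in; pose X := pq_axioms (test_edge (inl h))
  (fun i j => ~~ test_edge (inl h) i j) n.
have [i ile clos] := horn_closed_ex pi X.
have PQ i' j' : i' < n -> j' < n ->
    test_edge (inl h) i' j' || ~~ test_edge (inl h) i' j' by rewrite orbN.
have [|col|cli] := Theta_star_disjunction der pi_in clos _ PQ.
- by move=> phi; apply: (@horn_leq _ 0).
- apply: horn_leq ile _; apply: horn_sub col => phi.
  by apply: pq_axioms_sub.
case: (@clique_part_false h); apply: horn_sound der PQ _ _ cli => //.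
Qed.

(** The valuation [colour_val c] makes all [q] true, so it validates the axioms [all_q] and their
    closure, but it refutes [colour_part]. *)
Lemma horn_neg S pi c : derivation S pi ->
  ~~ horn pi (size pi) (all_q (inr c)) (colour_part n k).
Proof.
move=> der; apply/negP => col; apply: (@colour_part_false c).
by apply: horn_sound der _ _ _ col => // i j _ _; rewrite orbT.
Qed.

Lemma Theta_star_nk_slp S pi : derivation S pi ->
  ([::] ⇒ Some (Theta_star_nk n k)) \in pi ->
  exists s f, [/\ slp (gens I B C) s, f \in s, forall h, inl h \in f,
    forall c, inr c \notin f & size s <= (n ^ 2 + size pi + 4) ^ 4].
Proof.
move=> der pi_in.
have [||s [ss ws le]] := slp_horn_size pi _ _ all_q_gens.
- by rewrite mem_head.
- by rewrite !in_cons eqxx orbT.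
exists s, [set t | horn pi (size pi) (all_q t) (colour_part n k)]; split=> //.
- by move=> h; rewrite inE; apply: horn_pos der pi_in.
- by move=> c; rewrite inE; apply: horn_neg der.
apply: leq_trans le _.
(* There are [2 + #|V| ^ 2] generators, and [#|V| = k.+1 * k.-1 <= n]. *)
rewrite leq_exp2r // /gens /= size_image !card_prod !card_ord.
by have := leq_mul kn kn; move: (_ * k.-1) (size pi) => e m; rewrite -mulnn; lia.
Qed.

End Separation.

(** * Derivability *)

Section Provability.

Variable S : pred struct_rule.
Implicit Types (G H : seq formula).

Local Open Scope formula_scope.
Local Notation "⊢ s" := (provable S s) (at level 71).

Lemma derivation_cat pi pi' :
  derivation S pi -> derivation S pi' -> derivation S (pi ++ pi').
Proof.
move=> der; elim=> [|pi1 prems s _ IH inf sub]; first by rewrite cats0.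
rewrite -rcons_cat; apply: der_rcons IH inf _ => x /sub.
by rewrite mem_cat => ->; rewrite orbT.
Qed.

Lemma derivation_prems (prems : seq sequent) : (forall s, s \in prems -> ⊢ s) ->
  exists2 pi, derivation S pi & {subset prems <= pi}.
Proof.
elim: prems => [|s prems IH] H; first by exists [::] => //; apply: der_nil.
have [x xs|pi der sub] := IH; first by apply: H; rewrite in_cons xs orbT.
have [pi' [der' [pi0 e]]] := H s (mem_head _ _).
exists (pi' ++ pi); first exact: derivation_cat.
move=> x; rewrite in_cons mem_cat => /predU1P[->|/sub->]; last by rewrite orbT.
by rewrite e mem_rcons mem_head.
Qed.

Lemma provable_inference (prems : seq sequent) s :
  (forall s, s \in prems -> ⊢ s) ->
  inference S prems s -> ⊢ s.
Proof.
move=> /derivation_prems[pi der sub] inf.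
by exists (rcons pi s); split; [apply: der_rcons der inf sub|exists pi].
Qed.

Lemma provable_inference1 s1 s : inference S [:: s1] s -> ⊢ s1 -> ⊢ s.
Proof.
by move=> inf H; apply: provable_inference inf => x; rewrite inE => /eqP->.
Qed.

Lemma provable_inference2 s1 s2 s : inference S [:: s1; s2] s ->
  ⊢ s1 -> ⊢ s2 -> ⊢ s.
Proof.
move=> inf H1 H2; apply: provable_inference inf => x.
by rewrite !inE => /orP[]/eqP->.
Qed.

(** The conjunct [1] makes these formulas weakenable through [weak1] in the calculus for any [S]. *)
Definition units (ys : seq formula) : seq formula := [seq y ∧ 1 | y <- ys].

Lemma weaken_unit G H y D : ⊢ (G ++ H ⇒ D) -> ⊢ (G ++ (y ∧ 1) :: H ⇒ D).
Proof.
move=> H1; apply: provable_inference1; first exact: L_and2.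
by apply: provable_inference1 H1; exact: weak1.
Qed.

Lemma provable_unit ys y : y \in ys -> ⊢ (units ys ⇒ Some y).
Proof.
case/splitPr=> a b; rewrite /units map_cat /=.
elim: a => [|x a IH]; last exact: (weaken_unit (G := [::])).
elim: b => [|x b IH] /=; last exact: (weaken_unit (G := [:: _])).
apply: provable_inference1; first exact: (@L_and1 _ [::] [::]).
by apply: (provable_inference (prems := [::])) => //; exact: ax_id.
Qed.

Lemma provable_bigOr G x xs :
  x \in xs -> ⊢ (G ⇒ Some x) -> ⊢ (G ⇒ Some (bigOr xs)).
Proof.
elim: xs => // y [|z xs] IH; first by rewrite inE => /eqP->.
rewrite in_cons => /predU1P[<-|xxs] H.
  by apply: provable_inference1 H; exact: R_or1.
by apply: provable_inference1 (IH xxs H); exact: R_or2.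
Qed.

Lemma provable_bigAnd G xs : xs != [::] ->
  (forall x, x \in xs -> ⊢ (G ⇒ Some x)) -> ⊢ (G ⇒ Some (bigAnd xs)).
Proof.
elim: xs => // y [|z xs] IH _ H; first exact/H/mem_head.
apply: provable_inference2; first exact: R_and; first exact/H/mem_head.
by apply: IH => // x xxs; apply: H; rewrite in_cons xxs orbT.
Qed.

(** Unfolding the fusion and splitting each factor by [L_or] leaves one sequent for each choice
    [b]. *)
Lemma provable_cases (A : eqType) (xs : seq A) (f g : A -> formula) G H D :
  uniq xs ->
  (forall b : A -> bool,
     ⊢ (G ++ units [seq if b x then f x else g x | x <- xs] ++ H ⇒ D)) ->
  ⊢ (G ++ bigFus [seq (f x ∧ 1) ∨ (g x ∧ 1) | x <- xs] :: H ⇒ D).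
Proof.
elim: xs G => [|x xs IH] G /=.
  by move=> _ /(_ xpredT) HD; apply: provable_inference1 HD; exact: weak1.
case/andP=> xxs uxs HD.
(* [bigFus] has no trailing unit, so after the last factor no formula is left for the induction
   hypothesis. *)
have step G' : (forall b : A -> bool,
    ⊢ (G' ++ units [seq if b x then f x else g x | x <- xs] ++ H ⇒ D)) ->
  if xs is [::] then ⊢ (G' ++ H ⇒ D) else
  ⊢ (G' ++ bigFus [seq (f x ∧ 1) ∨ (g x ∧ 1) | x <- xs] :: H ⇒ D).
  case: xs IH uxs {xxs HD} => [|x' xs] IH uxs HD; first exact: (HD xpredT).
  exact: IH.
have branch b0 b : ⊢ ((G ++ [:: (if b0 then f x else g x) ∧ 1]) ++
    units [seq if b x then f x else g x | x <- xs] ++ H ⇒ D).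
  have := HD (fun y => if y == x then b0 else b y).
  rewrite /units /= eqxx -catA /=; congr (provable S (_ ++ _ :: map _ _ ++ _, _)).
  by apply/eq_in_map => y yxs; case: eqP yxs xxs => // -> ->.
have bt := step _ (branch true); have bf := step _ (branch false).
have -> : bigFus ((f x ∧ 1) ∨ (g x ∧ 1) ::
                  [seq (f x ∧ 1) ∨ (g x ∧ 1) | x <- xs]) =
  if xs is [::] then (f x ∧ 1) ∨ (g x ∧ 1) else
  ((f x ∧ 1) ∨ (g x ∧ 1)) ⊗ bigFus [seq (f x ∧ 1) ∨ (g x ∧ 1) | x <- xs].
  by case: (xs).
case: xs bt bf {IH xxs uxs HD step branch} => [|x' xs] bt bf.
  by apply: provable_inference2; [exact: L_or|move: bt|move: bf]; rewrite -catA.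
apply: provable_inference1; first exact: L_fus.
by apply: provable_inference2; [exact: L_or|move: bt|move: bf]; rewrite -catA.
Qed.

Lemma uniq_grid a b : uniq (grid a b).
Proof. by apply: allpairs_uniq => [||[? ?] [? ?]] //=; rewrite iota_uniq. Qed.

(** A graph with a loop is not colourable, in accordance with the disjuncts [i = j] of [alpha]. *)
Definition colourable n k (b : nat * nat -> bool) : bool :=
  [exists c : {ffun 'I_n -> 'I_k}, [forall i, forall j,
     b (val i, val j) ==> (c i != c j)]].

(** Either some vertex has no colour under [a], or picking a colour for each vertex gives a map
    that, not being a proper colouring, has a monochromatic edge. *)
Lemma provable_alpha n k (a b : nat * nat -> bool) : 0 < n -> 0 < k ->
  ~~ colourable n k b ->
  ⊢ (units [seq if a x then Var (Vs x.1 x.2) else Var (Vs' x.1 x.2)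
            | x <- grid n k]
     ++ units [seq if b x then Var (Vp x.1 x.2) else Var (Vq x.1 x.2)
               | x <- grid n n]
     ⇒ Some (alpha n k)).
Proof.
move=> n0 k0 nocol; rewrite /units -map_cat -/(units _).
have [/existsP[i /forallP ai]|] :=
    boolP [exists i : 'I_n, [forall l : 'I_k, ~~ a (val i, val l)]].
  apply: provable_inference1; first exact: R_or1.
  apply: (provable_bigOr (x := bigAnd [seq Var (Vs' i l) | l <- iota 0 k])).
    by apply: map_f; rewrite mem_iota ltn_ord.
  apply: provable_bigAnd => [|_ /mapP[l + ->]].
    by rewrite -size_eq0 size_map size_iota -lt0n.
  rewrite mem_iota => /= lk; apply: provable_unit.
  rewrite mem_cat; apply/orP; left.
  have il : (val i, l) \in grid n k by rewrite mem_grid ltn_ord lk.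
  by apply/mapP; exists (val i, l) => //; rewrite (negPf (ai (Ordinal lk))).
rewrite negb_exists => /forallP all_coloured.
pose c (i : 'I_n) := odflt (Ordinal k0) [pick l : 'I_k | a (val i, val l)].
have ac (i : 'I_n) : a (val i, val (c i)).
  rewrite /c; case: pickP => //= no; have := all_coloured i.
  by rewrite negb_forall => /existsP[l]; rewrite no.
move: nocol; rewrite /colourable negb_exists => /forallP/(_ [ffun i => c i]).
rewrite negb_forall => /existsP[i]; rewrite negb_forall => /existsP[j].
rewrite negb_imply negbK !ffunE => /andP[bij /eqP cij].
apply: provable_inference1; first exact: R_or2.
apply: provable_bigOr.
  by apply: (map_f _ (x := (val i, val j))); rewrite mem_grid !ltn_ord.
apply: (provable_bigOr (x := Var (Vs i (c i)) ∧ Var (Vs j (c i)) ∧ Var (Vp i j))).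
  by apply/mapP; exists (val (c i)); rewrite ?mem_iota ?ltn_ord.
apply: provable_inference2; first exact: R_and.
  apply: provable_unit; rewrite mem_cat; apply/orP; left; apply/mapP.
  by exists (val i, val (c i)); rewrite ?mem_grid ?ltn_ord //= ac.
apply: provable_inference2; first exact: R_and.
  apply: provable_unit; rewrite mem_cat; apply/orP; left; apply/mapP.
  by exists (val j, val (c i)); rewrite ?mem_grid ?ltn_ord //= cij ac.
apply: provable_unit; rewrite mem_cat; apply/orP; right; apply/mapP.
by exists (val i, val j); rewrite ?mem_grid ?ltn_ord //= bij.
Qed.

(** If every position is occupied, two of the [k.+1] chosen vertices share a colour by the
    pigeonhole principle, so their [q] is available. They may coincide, as a colourable graph has no
    loops. *)
Lemma provable_beta n k (a b : nat * nat -> bool) : 0 < n ->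
  colourable n k b ->
  ⊢ (units [seq if a x then Var (Vr x.1 x.2) else Var (Vr' x.1 x.2)
            | x <- grid n k.+1]
     ++ units [seq if b x then Var (Vp x.1 x.2) else Var (Vq x.1 x.2)
               | x <- grid n n]
     ⇒ Some (beta n k.+1)).
Proof.
move=> n0 /existsP[c /forallP cP]; rewrite /units -map_cat -/(units _).
have [/existsP[l /forallP al]|] :=
    boolP [exists l : 'I_k.+1, [forall i : 'I_n, ~~ a (val i, val l)]].
  apply: provable_inference1; first exact: R_or1.
  apply: (provable_bigOr (x := bigAnd [seq Var (Vr' i l) | i <- iota 0 n])).
    by apply: (map_f (fun l => bigAnd [seq Var (Vr' i l) | i <- iota 0 n]));
       rewrite mem_iota ltn_ord.
  apply: provable_bigAnd => [|_ /mapP[i + ->]].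
    by rewrite -size_eq0 size_map size_iota -lt0n.
  rewrite mem_iota => /= ilt; apply: provable_unit.
  rewrite mem_cat; apply/orP; left.
  have il : (i, val l) \in grid n k.+1 by rewrite mem_grid ltn_ord ilt.
  by apply/mapP; exists (i, val l) => //; rewrite (negPf (al (Ordinal ilt))).
rewrite negb_exists => /forallP all_chosen.
pose v (l : 'I_k.+1) := odflt (Ordinal n0) [pick i : 'I_n | a (val i, val l)].
have av (l : 'I_k.+1) : a (val (v l), val l).
  rewrite /v; case: pickP => //= no; have := all_chosen l.
  by rewrite negb_forall => /existsP[i]; rewrite no.
have [l [m [lm cvlm]]] : exists l m : 'I_k.+1, l < m /\ c (v l) = c (v m).
  have /injectivePn[l [m lm cvlm]] : ~~ injectiveb (c \o v).
    by apply/injectiveP => /leq_card; rewrite !card_ord ltnn.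
  case: (ltngtP l m) => [lt|lt|/val_inj e]; first by exists l, m.
    by exists m, l.
  by rewrite e eqxx in lm.
have bvlm : b (val (v l), val (v m)) = false.
  apply/negP => bvlm; have /forallP/(_ (v m)) := cP (v l).
  by rewrite bvlm cvlm eqxx.
apply: provable_inference1; first exact: R_or2.
apply: provable_bigOr.
  by apply: (map_f _ (x := (val (v l), val (v m)))); rewrite mem_grid !ltn_ord.
apply: (provable_bigOr
  (x := Var (Vr (v l) l) ∧ Var (Vr (v m) m) ∧ Var (Vq (v l) (v m)))).
  apply/mapP; exists (val l, val m) => //.
  by rewrite mem_filter mem_grid !ltn_ord /= lm.
apply: provable_inference2; first exact: R_and.
  apply: provable_unit; rewrite mem_cat; apply/orP; left; apply/mapP.
  by exists (val (v l), val l); rewrite ?mem_grid ?ltn_ord //= av.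
apply: provable_inference2; first exact: R_and.
  apply: provable_unit; rewrite mem_cat; apply/orP; left; apply/mapP.
  by exists (val (v m), val m); rewrite ?mem_grid ?ltn_ord //= av.
apply: provable_unit; rewrite mem_cat; apply/orP; right; apply/mapP.
by exists (val (v l), val (v m)); rewrite ?mem_grid ?ltn_ord //= bvlm.
Qed.

Theorem provable_Theta_star_nk n k : 0 < n -> 0 < k ->
  ⊢ ([::] ⇒ Some (Theta_star_nk n k)).
Proof.
move=> n0 k0; apply: provable_inference1; first exact: R_ldiv.
apply: (provable_cases (G := [::]) (H := [::])); first exact: uniq_grid.
move=> b; rewrite cats0 cat0s.
have [col|nocol] := boolP (colourable n k b).
  apply: provable_inference1; first exact: R_or2.
  apply: provable_inference1; first exact: R_ldiv.
  apply: (provable_cases (G := [::])); first exact: uniq_grid.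
  by move=> a; apply: provable_beta.
apply: provable_inference1; first exact: R_or1.
apply: provable_inference1; first exact: R_ldiv.
apply: (provable_cases (G := [::])); first exact: uniq_grid.
by move=> a; apply: provable_alpha.
Qed.

End Provability.

(** * Parameters *)

Lemma expn_root n d : 0 < d -> exists w, w ^ d <= n < w.+1 ^ d.
Proof.
move=> d0; elim: n => [|n [w /andP[lo hi]]].
  by exists 0; rewrite exp0n // exp1n.
have [lt|ge] := ltnP n.+1 (w.+1 ^ d).
  by exists w; rewrite lt (leq_trans lo).
exists w.+1; rewrite ge (leq_ltn_trans hi) //.
by rewrite ltn_exp2r.
Qed.

(** The factorial of [l] is at most [l ^ l]. *)
Lemma sunflower_bound_sq l : (16 * l ^ 2) ^ l * l`! <= (16 * l ^ 3) ^ l.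
Proof.
rewrite (_ : 16 * l ^ 3 = 16 * l ^ 2 * l); last by rewrite -mulnA -expnSr.
rewrite [leqRHS]expnMn leq_mul2l; apply/orP; right.
rewrite fact_prod -[X in l ^ X](subn1 l.+1) -prod_nat_const_nat.
by rewrite !big_nat; apply: leq_prod => i /andP[].
Qed.

(* The sunflower size [p = 16 l^2] makes [2 ^ p] exceed [M ^ 2], which is at most
   [2 ^ (8 l + 6 l^2)]. *)
Lemma size_bound_dichotomy l k Z : 2 <= l -> 512 * l ^ 6 < k ->
  let M := (16 * l ^ 2) ^ l * l`! in
  k.-1 ^ l.+1 <= Z * M ^ 2 \/ 2 ^ (16 * l ^ 2) <= Z * (4 * M ^ 2) -> 2 ^ l <= Z.
Proof.
move=> l2 lk M.
have M2 : M ^ 2 <= (256 * l ^ 6) ^ l.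
  apply: leq_trans (_ : ((16 * l ^ 3) ^ l) ^ 2 <= _).
    by rewrite leq_exp2r // sunflower_bound_sq.
  by rewrite expnAC expnMn -expnM.
case=> H.
  (* Here [k.-1] is at least twice [256 * l ^ 6], and the [l]-th power of the latter bounds
     [M ^ 2]. *)
  have b0 : 0 < (256 * l ^ 6) ^ l by rewrite expn_gt0 muln_gt0 expn_gt0 (ltnW l2).
  rewrite -(leq_pmul2r b0) -expnMn mulnA (leq_trans _ (leq_mul (leqnn Z) M2)) //.
  apply: leq_trans H; rewrite (@leq_trans (k.-1 ^ l)) //.
    by rewrite leq_exp2r ?(ltnW l2) //; lia.
  by rewrite leq_pexp2l //; lia.
have l6 : (256 * l ^ 6) ^ l <= 2 ^ ((8 + 6 * l) * l).
  rewrite expnM leq_exp2r ?(ltnW l2) // expnD leq_mul //.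
  by rewrite mulnC expnM leq_exp2r // ltnW // ltn_expl.
have e : 2 ^ (2 + (8 + 6 * l) * l) = 4 * 2 ^ ((8 + 6 * l) * l) by rewrite expnD.
have x0 : 0 < 2 ^ (2 + (8 + 6 * l) * l) by rewrite expn_gt0.
rewrite -(leq_pmul2r x0) -expnD.
apply: leq_trans (_ : 2 ^ (16 * l ^ 2) <= _).
  by rewrite leq_exp2l // -mulnn; nia.
apply: leq_trans H _; rewrite e leq_mul2l; apply/orP; right.
by rewrite leq_mul2l (leq_trans M2).
Qed.

Lemma sqrt_bounds n (k := Nat.sqrt n) : k * k <= n < k.+1 * k.+1.
Proof.
have [lo hi] := PeanoNat.Nat.sqrt_spec n (PeanoNat.Nat.le_0_l n).
by apply/andP; split; [apply/leP|apply/ltP].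
Qed.

Lemma succ_mul_pred k : k.+1 * k.-1 <= k * k.
Proof. by case: k => // k; lia. Qed.

(** The threshold is [289 = 4 * 72 + 1]; the extra [w] absorbs the additive [8]. *)
Lemma linear_lt_square w : 289 <= w -> (72 * w).+2 * 4 < w ^ 2.
Proof.
move=> w0; apply: (@leq_trans (289 * w)); first by lia.
by rewrite -mulnn leq_mul2r w0 orbT.
Qed.

(** Each of the three summands is at most [2 ^ (72 * w)], because [w.+1 <= 2 ^ w]. *)
Lemma circuit_size_small w n m : 289 <= w -> n < w.+1 ^ 36 -> m < 2 ^ w.+1 ->
  (n ^ 2 + m + 4) ^ 4 < 2 ^ w ^ 2.
Proof.
move=> w0 hi small.
have n72 : n ^ 2 <= 2 ^ (72 * w).
  rewrite (_ : 72 * w = w * 36 * 2); last by rewrite -mulnA mulnC.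
  rewrite !expnM leq_exp2r // (leq_trans (ltnW hi)) // leq_exp2r //.
  exact: ltn_expl.
have w1 : 2 ^ w.+1 <= 2 ^ (72 * w).
  by rewrite leq_exp2l //; move: w0; clear; lia.
have w4 : 4 <= 2 ^ (72 * w).
  by rewrite -[4]/(2 ^ 2) leq_exp2l //; move: w0; clear; lia.
apply: (@leq_ltn_trans ((2 ^ (72 * w).+2) ^ 4)).
  rewrite leq_exp2r // [2 ^ _.+2]expnS [2 ^ _.+1]expnS.
  move: n72 w1 w4 small; clear.
  by move: (n ^ 2) (2 ^ w.+1) (2 ^ (72 * w)) => a b c; lia.
by rewrite -expnM ltn_exp2l // linear_lt_square.
Qed.

(** The approximating cliques have size at most [l = w ^ 2]. Since [k >= w ^ 18] exceeds
    [512 * l ^ 6], a separating circuit has size at least [2 ^ (w ^ 2)], more than fewer than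
    [2 ^ w.+1] lines could yield. *)
Lemma Theta_star_size S n w pi : 289 <= w -> w ^ 36 <= n < w.+1 ^ 36 ->
  proof_of S ([::] ⇒ Some (Theta_star n)) pi -> 2 ^ w.+1 <= size pi.
Proof.
move=> w0 /andP[lo hi] [der [pi0 epi]].
have pi_in : ([::] ⇒ Some (Theta_star n)) \in pi.
  by rewrite epi mem_rcons mem_head.
set k := Nat.sqrt n in pi_in; rewrite /Theta_star -/k in pi_in.
have /andP[kn nk] := sqrt_bounds n; rewrite -/k in kn nk.
have wpos : 0 < w by apply: leq_trans w0.
have w30 : 30 <= w by apply: leq_trans w0.
have wk : w ^ 18 <= k.
  rewrite -ltnS -(@ltn_exp2r _ _ 2) // -expnM.
  by apply: leq_ltn_trans lo _; rewrite -mulnn.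
have w12 : 512 * (w ^ 2) ^ 6 < k.
  apply: leq_trans wk; rewrite -expnM -[18]/(6 + 12) expnD.
  apply: leq_trans (_ : 513 * w ^ 12 <= _).
    by have : 0 < w ^ 12 by [rewrite expn_gt0 wpos]; move: (w ^ 12) => x; lia.
  rewrite leq_mul2r; apply/orP; right; apply: leq_trans (_ : w ^ 2 <= _).
    exact: leq_trans (leq_mul w30 w30).
  by rewrite leq_pexp2l.
have k2 : 2 * (w ^ 2) ^ 2 <= k.
  apply: leq_trans (ltnW w12); apply: leq_mul => //.
  by rewrite leq_pexp2l // expn_gt0 wpos.
have k0 : 1 < k by apply: leq_trans k2; rewrite leq_pmulr // !expn_gt0 wpos.
have l2 : 2 <= w ^ 2 by apply: leq_trans (leq_mul w30 w30).
have n0 : 0 < n by apply: leq_trans lo; rewrite expn_gt0 wpos.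
have kk := leq_trans (succ_mul_pred k) kn.
have [s [f [ss fs fp fn le]]] := Theta_star_nk_slp n0 (ltnW k0) kk der pi_in.
have p2 : 2 <= 16 * (w ^ 2) ^ 2.
  by rewrite (@leq_trans 16) // leq_pmulr // !expn_gt0 wpos.
have lC : 2 * (w ^ 2) ^ 2 <= #|'I_k| by rewrite card_ord.
have B0 : 0 < #|'I_k.-1| by rewrite card_ord ltn_predRL.
have := slp_clique_colouring l2 p2 lC ss fs B0 fp fn; rewrite card_ord.
move=> /(size_bound_dichotomy l2 w12) big.
rewrite leqNgt; apply/negP => small.
have := leq_trans big le.
by rewrite leqNgt (circuit_size_small w0 hi small).
Qed.

Theorem corollary6p3 (R : realType) (S : pred struct_rule) :
  (forall n : nat, (1 <= n)%N -> provable S ([::] ⇒ Some (Theta_star n))) /\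
  (exists eps : R, (0 < eps)%R /\
    exists N : nat, forall (n : nat) (pi : seq sequent),
      (N <= n)%N -> proof_of S ([::] ⇒ Some (Theta_star n)) pi ->
      (2 `^ (n%:R `^ eps) <= (size pi)%:R :> R)%R).
Proof.
split=> [n n0|].
  apply: provable_Theta_star_nk => //.
  rewrite lt0n; apply: contraTneq n0 => e.
  by have := sqrt_bounds n; rewrite e; case: n {e}.
(* From [n < w.+1 ^ 36] the 36th root of [n] is at most [w.+1], the exponent in
   [Theta_star_size]. *)
exists (36%:R^-1)%R; split; first by rewrite invr_gt0 ltr0n.
have [w0 w0big] : exists w0, 289 <= w0 by exists 289.
exists (w0 ^ 36) => n pi Nn prf.
have [w /andP[lo hi]] := @expn_root n 36 isT.
have ww : w0 <= w by rewrite -ltnS -(@ltn_exp2r _ _ 36) // (leq_ltn_trans Nn).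
have := Theta_star_size (leq_trans w0big ww) _ prf; rewrite lo hi => /(_ isT).
rewrite -(ler_nat R); apply: Order.POrderTheory.le_trans.
rewrite natrX -powR_mulrn ?ler0n //.
apply: ler_powR; first by rewrite ler1n.
apply: (@Order.POrderTheory.le_trans _ _ (((w.+1 ^ 36)%:R : R) `^ 36%:R^-1)%R).
  by rewrite ge0_ler_powR ?nnegrE ?ler0n ?invr_ge0 ?ler_nat ?(ltnW hi).
by rewrite natrX -powR_mulrn ?ler0n // -powRrM divff ?powRr1 ?ler0n // pnatr_eq0.
Qed.
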